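(* Suppose $(X_t)_{t>0}$ is a quadratic harness with parameters $q,\eta,\theta,\sigma,\tau$ such that $\sigma=0$, $-1<q\le1$, and $1+[n]_q\eta\theta+[n]_q^2\tau\eta^2>0$ for all $n$. If for each $t>0$ the random variable $X_t$ has infinite support, then the monic orthogonal martingale polynomials $p_n(x;t)$ of $(X_t)$ are given by the recurrence $$x\,p_n(x;t)=p_{n+1}(x;t)+\big(\eta t+\theta+([n]_q+[n-1]_q)\eta\tau\big)[n]_q\,p_n(x;t)+(t+\tau[n-1]_q)\big(1+[n-1]_q\eta\theta+[n-1]_q^2\tau\eta^2\big)[n]_q\,p_{n-1}(x;t),\quad n\ge1,$$ with the initial condition $p_0(x;t)=1$, $p_1(x;t)=x$.
   Context: $[n]_q=1+q+\dots+q^{n-1}$, $[0]_q=0$. Equalities between conditional expectations hold almost surely. $(X_t)_{t>0}$ is a separable square-integrable real process; $\mathcal F_{s,u}=\sigma\{X_t:t\in(0,s]\cup[u,\infty)\}$, $\mathcal F_{\le s}=\sigma\{X_t:0<t\le s\}$; $\mathrm{Var}[X\mid\mathcal F]=\mathbb{E}[X^2\mid\mathcal F]-(\mathbb{E}[X\mid\mathcal F])^2$; $\Delta_{s,u}=\frac{X_u-X_s}{u-s}$, $\widetilde\Delta_{s,u}=\frac{uX_s-sX_u}{u-s}$. For real $q,\eta,\theta$ and $\sigma,\tau\ge0$, $(X_t)$ is a quadratic harness with parameters $q,\eta,\theta,\sigma,\tau$ if $\mathbb{E}(X_t)=0$, $\mathbb{E}(X_sX_t)=\min\{s,t\}$ for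 all $s,t>0$, and for all $0<s<t<u$ $$\mathbb{E}[X_t\mid\mathcal F_{s,u}]=\tfrac{u-t}{u-s}X_s+\tfrac{t-s}{u-s}X_u,$$ $$\mathrm{Var}[X_t\mid\mathcal F_{s,u}]=\tfrac{(u-t)(t-s)}{u(1+\sigma s)+\tau-qs}\Big(1+\eta\widetilde\Delta_{s,u}+\theta\Delta_{s,u}+\sigma\widetilde\Delta_{s,u}^2+\tau\Delta_{s,u}^2-(1-q)\Delta_{s,u}\widetilde\Delta_{s,u}\Big).$$ Orthogonal martingale polynomials for $(X_t)$: polynomials $p_n(x;t)$ in $x$ of degree $n$ (with $p_n(X_t;t)$ square-integrable) such that $\mathbb{E}[p_n(X_t;t)\mid\mathcal F_{\le s}]=p_n(X_s;s)$ for all $0<s<t$, $n\ge0$, and $\mathbb{E}(p_n(X_t;t)p_m(X_t;t))=0$ for all $t>0$, $n\ne m$. ''Infinite support'' means the support of the law of $X_t$ is an infinite set. *)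

(* Defs.v *)
From HB Require Import structures.
From mathcomp Require Import all_boot all_order all_algebra.
From mathcomp Require Import all_classical all_reals all_analysis.

Set Implicit Arguments.
Unset Strict Implicit.
Unset Printing Implicit Defensive.

Import Order.TTheory GRing.Theory Num.Theory.
Import numFieldNormedType.Exports.

Local Open Scope classical_set_scope.
Local Open Scope ring_scope.

Definition qnum (R : realType) (q : R) (n : nat) : R := \sum_(i < n) q ^+ i.

Section conditioning.
Context (d : measure_display) (T : measurableType d) (R : realType)
        (P : probability T R).

(* [is_cond_exp F Z Y] : E[Z | F] = Y almost surely, for [Y] that is itself
   F-measurable, i.e. [Y] is a version of E[Z | F].  [F] is intended to be a
   sub-sigma-algebra of the measurable sets of [T]. *)
Definition is_cond_exp (F : set (set T)) (Z Y : T -> R) : Prop :=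
  [/\ P.-integrable setT (EFin \o Z),
      P.-integrable setT (EFin \o Y),
      preimage_set_system setT Y measurable `<=` F &
      forall A, F A ->
        (\int[P]_(w in A) (Y w)%:E = \int[P]_(w in A) (Z w)%:E)%E].

(* Var[Z | F] = E[Z^2 | F] - (E[Z | F])^2 = V almost surely; versions are
   a.s. unique, so the choice of [M] and [S] is immaterial. *)
Definition is_cond_var (F : set (set T)) (Z V : T -> R) : Prop :=
  exists M S : T -> R,
    [/\ is_cond_exp F Z M,
        is_cond_exp F (fun w => Z w ^+ 2) S &
        {ae P, forall w, V w = S w - M w ^+ 2}].

Definition law_support (Y : {RV P >-> R}) : set R :=
  [set x | forall U : set R, open_nbhs x U -> (0 < distribution P Y U)%E].

End conditioning.

(* Processes are indexed by the whole of [R]; only the times t > 0 are ever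
   used, the variables [X t] with t <= 0 being irrelevant. *)
Section processes.
Context (d : measure_display) (T : measurableType d) (R : realType)
        (P : probability T R) (X : R -> {RV P >-> R}).

Definition sigma_of (I : set R) : set (set T) :=
  <<s \bigcup_(t in I) preimage_set_system setT (X t) measurable >>.

(* F_{s,u} *)
Definition two_sided (s u : R) : set (set T) :=
  sigma_of (`]0, s] `|` `[u, +oo[).

(* F_{<= s} *)
Definition past (s : R) : set (set T) := sigma_of `]0, s].

(* Doob's separability: one countable set of times and one null set serve all
   open sets of times and all closed intervals (possibly unbounded) of
   values. *)
Definition separable_process : Prop :=
  exists (D : set R) (N : set T),
    [/\ countable D, D `<=` `]0, +oo[, P.-negligible N &
     forall I F : set R, open I -> I `<=` `]0, +oo[ ->
       closed F -> is_interval F ->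
       [set w | forall t, (I `&` D) t -> F (X t w)] `\`
       [set w | forall t, I t -> F (X t w)] `<=` N].

Definition Delta (s u : R) (w : T) : R := (X u w - X s w) / (u - s).

Definition tDelta (s u : R) (w : T) : R := (u * X s w - s * X u w) / (u - s).

Record quadratic_harness (q eta theta sigma tau : R) : Prop := {
  qh_sigma_ge0 : 0 <= sigma;
  qh_tau_ge0 : 0 <= tau;
  qh_separable : separable_process;
  qh_square_integrable :
    forall t, 0 < t -> (X t : T -> R) \in Lfun P 2%:E;
  qh_mean : forall t, 0 < t -> ('E_P[X t] = 0)%E;
  qh_cov : forall s t, 0 < s -> 0 < t ->
    ('E_P[fun w => (X s w * X t w)%R] = (Num.min s t)%:E)%E;
  qh_cond_mean : forall s t u, 0 < s -> s < t -> t < u ->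
    is_cond_exp P (two_sided s u) (X t)
      (fun w => (u - t) / (u - s) * X s w + (t - s) / (u - s) * X u w);
  qh_cond_var : forall s t u, 0 < s -> s < t -> t < u ->
    is_cond_var P (two_sided s u) (X t)
      (fun w => (u - t) * (t - s) / (u * (1 + sigma * s) + tau - q * s) *
        (1 + eta * tDelta s u w + theta * Delta s u w
         + sigma * tDelta s u w ^+ 2 + tau * Delta s u w ^+ 2
         - (1 - q) * Delta s u w * tDelta s u w))
}.

(* [p n t] is the polynomial x |-> p_n(x; t). *)
Record orthogonal_martingale_polys (p : nat -> R -> {poly R}) : Prop := {
  omp_degree : forall n t, 0 < t -> size (p n t) = n.+1;
  omp_square_integrable : forall n t, 0 < t ->
    (fun w => (p n t).[X t w]) \in Lfun P 2%:E;
  omp_martingale : forall n s t, 0 < s -> s < t ->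
    is_cond_exp P (past s) (fun w => (p n t).[X t w])
                           (fun w => (p n s).[X s w]);
  omp_orthogonal : forall n m t, 0 < t -> n <> m ->
    ('E_P[fun w => ((p n t).[X t w] * (p m t).[X t w])%R] = 0)%E
}.

Definition monic_orthogonal_martingale_polys (p : nat -> R -> {poly R}) :=
  orthogonal_martingale_polys p /\ forall n t, 0 < t -> p n t \is monic.

End processes.

(* Main.v *)
Require Import Defs.
From HB Require Import structures.
From mathcomp Require Import all_boot all_order all_algebra.
From mathcomp Require Import all_classical all_reals all_analysis.
From mathcomp Require Import measurable_realfun ring lra.
Import Order.TTheory GRing.Theory Num.Theory.
Import numFieldNormedType.Exports.
Local Open Scope classical_set_scope.
Local Open Scope ring_scope.

(** Conditioning on F_{s,u} and on one-sided sigma-fields gives two expressions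
for E[X_t X_u W] and for E[X_t^2 W].  For a candidate martingale polynomial
p_{n+2}, with W depending on the past of s, the defects
D(r) = E[W p_{n+2}(X_r; r)] - E[W p_{n+2}(X_s; s)] then satisfy
D(t) = a D(u) = b D(u), where a comes from the linear regression, b from the
quadratic conditional variance, and a <> b; hence D = 0.  That the lower order
terms cancel in the second equation is the q-commutation relation of the Jacobi
matrix of the recurrence.

All moments exist because the conditional variance of X_t given X_s is only
linear in X_s, while E[X_s (X_t - X_s) | X_t] = c X_t^2 + O(1 + |X_t|) with
c > 0: testing X_s (X_t - X_s) against truncations of |X_t|^k - |X_s|^k bounds
E |X_t|^{k+2} in terms of the moments of order k + 1.

Orthogonality follows from E p_n(X_t; t) = 0 for n >= 1 and the recurrence, and
uniqueness from the fact that a nonzero polynomial has finitely many roots. *)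

(** * The Jacobi matrix and its q-commutation relation *)

(** The hypotheses condition on past and future jointly. One-sided information is recovered from
    growth: Cauchy-Schwarz gives E(W X_r)^2 <= r E(W^2), while the two-sided regression makes r |->
    E(W X_r) affine on the side of the time axis that W does not see. Conditional identities are
    used in the tested form E(W Z) = E(W Y), so for a fixed W they become linear equations between
    real numbers.

    The coefficients of the two defect equations are a = (t-s)/(u-s) and a b with a - b = (u-t)(t-s)
    / ((u-s)(u+tau-qs)); this is nonzero because q <= 1 and tau >= 0 keep u+tau-qs positive. The
    same gap settles the one-sided second moments.

    The induction tests against polynomials in X_u of every degree, so it cannot start before all
    moments are known to be finite. The moment bound therefore has to be obtained from bounded W
    alone. *)

Section jacobi.
Context {R : realType}.
Variables (q eta theta tau : R).
Local Notation qnum := (qnum q).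

Lemma qnum0 : qnum 0 = 0.
Proof. by rewrite /Defs.qnum big_ord0. Qed.

Lemma qnumS n : qnum n.+1 = 1 + q * qnum n.
Proof.
rewrite /Defs.qnum big_ord_recl expr0 mulr_sumr; congr (_ + _).
by apply: eq_bigr => i _; rewrite exprS.
Qed.

Definition jacobi_diag (n : nat) (t : R) : R :=
  (eta * t + theta + (qnum n + qnum n.-1) * eta * tau) * qnum n.

Definition jacobi_sub (n : nat) (t : R) : R :=
  (t + tau * qnum n.-1)
  * (1 + qnum n.-1 * eta * theta + qnum n.-1 ^+ 2 * tau * eta ^+ 2) * qnum n.

(* If [e n = E(W p_n(X_t; t))] for all [n], then [J t e n = E(W X_t p_n(X_t; t))]. *)
Definition jacobi (t : R) (e : nat -> R) (n : nat) : R :=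
  e n.+1 + jacobi_diag n t * e n + jacobi_sub n t * e n.-1.
Local Notation J := jacobi.

(** Write J_t = A + t B, so that A corresponds to [tDelta] and B to [Delta]. After clearing
    denominators the identity is A B - q B A = 1 + eta A + theta B + tau B^2, evaluated in row m.
    The operators do not commute: the mixed product must be J_u J_s, later time outermost, which is
    the order in which E(W X_s X_u p_m(X_u; u)) expands. *)
Lemma J_qcomm (s t u : R) (e : nat -> R) m : u - s != 0 -> u + tau - q * s != 0 ->
  let ss := J s (J s e) m in let su := J u (J s e) m in let uu := J u (J u e) m in
  J t (J t e) m =
  ((u - t) ^+ 2 * ss + 2 * (u - t) * (t - s) * su + (t - s) ^+ 2 * uu) / (u - s) ^+ 2
  + (u - t) * (t - s) / (u + tau - q * s) *
   (e m + eta * ((u * J s e m - s * J u e m) / (u - s)) + theta * ((J u e m - J s e m) / (u - s))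
    + tau * ((uu - 2 * su + ss) / (u - s) ^+ 2)
    - (1 - q) * ((u * su - s * uu - u * ss + s * su) / (u - s) ^+ 2)).
Proof.
move=> h1 h2.
rewrite /jacobi /jacobi_diag /jacobi_sub.
(* [qnumS] does not apply to the truncated predecessors of [m = 0] and [m = 1];
   there the offending terms carry a factor [qnum 0]. *)
by case: m => [|[|m]] /=; rewrite ?qnumS ?qnum0; field; rewrite h1 h2.
Qed.

End jacobi.

(** * Expectations and conditional expectations *)

Section expectation.
Context {d : measure_display} {T : measurableType d} {R : realType}.
Variable P : probability T R.
Implicit Types f g W Z Y : T -> R.

Definition integ f := P.-integrable setT (EFin \o f).
Definition expect f : R := \int[P]_w f w.
Local Notation Ex := expect.

Lemma integ_mfun f : integ f -> measurable_fun setT f.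
Proof. by move=> /integrableP[/measurable_EFinP]. Qed.

Lemma EFin_Ex f : integ f -> (Ex f)%:E = (\int[P]_w (f w)%:E)%E.
Proof. by move=> fi; rewrite fineK//; exact: integrable_fin_num. Qed.

Lemma eq_integ f g : f =1 g -> integ f -> integ g.
Proof. by move=> fg; apply: eq_integrable => // w _ /=; rewrite fg. Qed.

Lemma eq_Ex f g : f =1 g -> Ex f = Ex g.
Proof. by move=> fg; apply: eq_Rintegral => w _; exact: fg. Qed.

Lemma le_integ f g : measurable_fun setT f -> (forall w, `|f w| <= `|g w|) ->
  integ g -> integ f.
Proof.
move=> mf fg; apply: le_integrable => //; first exact/measurable_EFinP.
by move=> w _ /=; rewrite lee_fin fg.
Qed.

Lemma integ_cst c : integ (fun=> c).
Proof. exact: (finite_measure_integrable_cst P c measurableT). Qed.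

Lemma integD f g : integ f -> integ g -> integ (fun w => f w + g w).
Proof. by move=> fi gi; exact: (integrableD measurableT fi gi). Qed.

Lemma integZ c f : integ f -> integ (fun w => c * f w).
Proof. by move=> fi; exact: (integrableZl measurableT c fi). Qed.

Lemma integB f g : integ f -> integ g -> integ (fun w => f w - g w).
Proof. by move=> fi gi; exact: (integrableB measurableT fi gi). Qed.

Lemma integ_norm f : integ f -> integ (fun w => `|f w|).
Proof. by move=> fi; exact: (integrable_norm fi). Qed.

Lemma ExD f g : integ f -> integ g -> Ex (fun w => f w + g w) = Ex f + Ex g.
Proof. by move=> fi gi; exact: (RintegralD measurableT fi gi). Qed.

Lemma ExB f g : integ f -> integ g -> Ex (fun w => f w - g w) = Ex f - Ex g.
Proof. by move=> fi gi; exact: (RintegralB measurableT fi gi). Qed.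

Lemma ExZ c f : integ f -> Ex (fun w => c * f w) = c * Ex f.
Proof. by move=> fi; exact: (RintegralZl _ measurableT fi). Qed.

Lemma Ex_cst c : Ex (fun=> c) = c.
Proof.
rewrite /expect (Rintegral_cst P measurableT c) -[RHS]mulr1; congr (_ * _).
exact: (congr1 fine (probability_setT P)).
Qed.

Lemma le_Ex f g : integ f -> integ g -> (forall w, f w <= g w) -> Ex f <= Ex g.
Proof. by move=> fi gi fg; exact: (le_Rintegral measurableT fi gi). Qed.

Lemma Ex_ge0 f : (forall w, 0 <= f w) -> 0 <= Ex f.
Proof. by move=> f0; exact: Rintegral_ge0. Qed.

Lemma le_norm_Ex f : integ f -> `|Ex f| <= Ex (fun w => `|f w|).
Proof. by move=> fi; exact: (le_normr_Rintegral measurableT fi). Qed.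

(** Linear combinations are lists of pairs (coefficient, function). The pointwise decomposition is
    then a [ring] goal, and integrability reduces to one condition per entry; [Ex_lin] shares this
    format. *)
Lemma integ_lin (s : seq (R * (T -> R))) f :
  (forall w, f w = \sum_(c <- s) c.1 * c.2 w) ->
  foldr (fun c Q => integ c.2 /\ Q) True s -> integ f.
Proof.
elim: s f => [|c s IH] f fE /=.
  by move=> _; apply: (eq_integ (fun=> 0)) (integ_cst 0) => w; rewrite fE big_nil.
move=> [ci /(IH (fun w => \sum_(c <- s) c.1 * c.2 w) (fun=> erefl)) si].
apply: (eq_integ _ _ _ (integD _ _ (integZ c.1 _ ci) si)) => w.
by rewrite fE big_cons.
Qed.

Lemma Ex_lin (s : seq (R * (T -> R))) f :
  (forall w, f w = \sum_(c <- s) c.1 * c.2 w) ->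
  foldr (fun c Q => integ c.2 /\ Q) True s ->
  Ex f = \sum_(c <- s) c.1 * Ex c.2.
Proof.
elim: s f => [|c s IH] f fE /=.
  by move=> _; rewrite big_nil (eq_Ex _ (fun=> 0)) ?Ex_cst// => w; rewrite fE big_nil.
move=> [ci si]; rewrite big_cons -(IH (fun w => \sum_(c <- s) c.1 * c.2 w))//.
rewrite -ExZ// -ExD//; last exact: (integ_lin s).
  by apply: eq_Ex => w; rewrite fE big_cons.
exact: integZ.
Qed.

Lemma integ_indic (A : set T) f : measurable A -> integ f ->
  integ (fun w => \1_A w * f w).
Proof.
move=> mA fi; apply: (le_integ _ f) => //.
  by apply: measurable_funM; [exact: measurable_indic|exact: integ_mfun].
move=> w; rewrite normrM indicE ler_piMl//.
by case: (w \in A); rewrite ?normr1 ?normr0.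
Qed.

Lemma Ex_indic (A : set T) f : measurable A ->
  Ex (fun w => \1_A w * f w) = \int[P]_(w in A) f w.
Proof.
move=> mA; rewrite Rintegral_mkcond; apply: eq_Ex => w.
by rewrite patchE indicE; case: ifP => _; rewrite ?mul1r ?mul0r.
Qed.

Lemma bounded_integ (M : R) f : measurable_fun setT f ->
  (forall w, `|f w| <= M) -> integ f.
Proof.
move=> mf fM; apply: (le_integ _ (fun=> M)) => //; last exact: integ_cst.
by move=> w; rewrite (le_trans (fM w))// ler_norm.
Qed.

(** Monotone convergence in the truncation level: a bound on the truncated expectations that is
    uniform in n becomes integrability of the untruncated product. *)
Lemma integ_truncated (B : R) W Z :
  measurable_fun setT W -> measurable_fun setT Z ->
  (forall w, 0 <= W w) -> (forall w, 0 <= Z w) ->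
  (forall n : nat, integ (fun w => Num.min (W w) n%:R * Z w)) ->
  (forall n : nat, Ex (fun w => Num.min (W w) n%:R * Z w) <= B) ->
  integ (fun w => W w * Z w).
Proof.
move=> mW mZ W0 Z0 ig leB.
have mt n : measurable_fun setT (fun w => Num.min (W w) n%:R * Z w).
  exact: integ_mfun.
apply/integrableP; split.
  by apply/measurable_EFinP; exact: measurable_funM.
pose g n w := (Num.min (W w) n%:R * Z w)%:E.
have g0 n w : setT w -> (0 <= g n w)%E.
  by move=> _; rewrite lee_fin mulr_ge0// le_min W0 ler0n.
have ndg w : setT w -> {homo g ^~ w : a b / (a <= b)%N >-> (a <= b)%E}.
  move=> _ a b ab; rewrite lee_fin ler_wpM2r//.
  by rewrite le_min ge_min lexx/= ge_min ler_nat ab orbT.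
have mg n : measurable_fun setT (g n) by exact/measurable_EFinP.
have := cvg_monotone_convergence measurableT mg g0 ndg (mu := P).
rewrite (_ : (\int[P]_x limn (g ^~ x) =
  \int[P]_x `|(EFin \o (fun w => W w * Z w)%R) x|)%E); last first.
  apply: eq_integral => w _; rewrite gee0_abs ?lee_fin ?mulr_ge0//.
  apply: cvg_lim => //.
  apply: (@cvg_trans _ (EFin (W w * Z w) @[_ --> \oo])); last exact: cvg_cst.
  apply: near_eq_cvg.
  exists (Num.bound (W w)) => // n /= Nn.
  rewrite /g min_l//.
  rewrite ltW// (lt_le_trans (archi_boundP _))// ler_nat//.
move=> cvgI.
apply: (@le_lt_trans _ _ B%:E); last exact: ltry.
move: (cvgI); move/cvg_lim => <- //.
apply: lime_le; first by apply/cvg_ex; eexists; exact: cvgI.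
apply: nearW => n.
by rewrite -EFin_Ex ?lee_fin ?leB.
Qed.

End expectation.

(** Measurability for a sub-sigma-field is put on the type [g_sigma_algebraType G], so that the
    general lemmas on sums, products and approximation of measurable functions apply to it;
    [gmfun_preimage] translates to the form used in [is_cond_exp]. *)
Definition gmfun {d : measure_display} {T : measurableType d} {R : realType}
    (G : set (set T)) (W : T -> R) : Prop :=
  measurable_fun (setT : set (g_sigma_algebraType G))
    (W : g_sigma_algebraType G -> R).

(** * Conditional expectations tested against unbounded random variables *)

Section conditional_expectation.
Context {d : measure_display} {T : measurableType d} {R : realType}.
Variable P : probability T R.
Variable G : set (set T).
Hypothesis GT : <<s G >> `<=` measurable.
Implicit Types W Z Y D f : T -> R.

Local Notation integ := (integ P).
Local Notation Ex := (expect P).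

Lemma gmfun_mfun W : gmfun G W -> measurable_fun setT W.
Proof. by move=> mW _ B mB; apply: GT; exact: (mW measurableT _ mB). Qed.

Lemma gmfun_preimage W : gmfun G W <-> preimage_set_system setT W measurable `<=` <<s G >>.
Proof.
split=> [mW _ [B mB <-]|mW mT B mB]; first exact: (mW measurableT _ mB).
by apply: mW; exists B.
Qed.

Lemma gmfun_indic (A : set T) : <<s G >> A -> gmfun G (\1_A : T -> R).
Proof. by move=> GA; exact: (@measurable_indic _ (g_sigma_algebraType G)). Qed.

Import HBNNSimple.

(** For W >= 0, simple functions of the sub-sigma-field increase to W, and |W D| dominates their
    products with D, so dominated convergence carries the identity from indicators to W. A signed W
    is split into positive and negative parts, whose products with D are again dominated by |W
    D|. *)
Lemma Ex_test0 D W : integ D ->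
  (forall A, <<s G >> A -> Ex (fun w => \1_A w * D w) = 0) ->
  gmfun G W -> integ (fun w => W w * D w) -> Ex (fun w => W w * D w) = 0.
Proof.
move=> iD D0.
have nonneg W' : gmfun G W' -> (forall w, 0 <= W' w) ->
    integ (fun w => W' w * D w) -> Ex (fun w => W' w * D w) = 0.
  move=> mW W0 iWD.
  have mW' : measurable_fun (setT : set (g_sigma_algebraType G))
      (EFin \o W' : g_sigma_algebraType G -> _) by exact/measurable_EFinP.
  have W0' w : (setT : set (g_sigma_algebraType G)) w -> (0 <= (EFin \o W') w)%E.
    by move=> _; rewrite lee_fin.
  pose phi := nnsfun_approx measurableT mW'.
  have phicvg w : EFin \o phi ^~ w @ \oo --> (W' w)%:E.
    exact: (cvg_nnsfun_approx measurableT mW' W0').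
  have mphi n : gmfun G (phi n) by exact: measurable_funPT.
  have phile n w : phi n w <= W' w.
    rewrite -lee_fin.
    rewrite -(cvg_lim (@ereal_hausdorff R) (phicvg w)).
    apply: lime_ge; first by apply/cvg_ex; exists (W' w)%:E; exact: phicvg.
    exists n => // m /= nm; rewrite lee_fin.
    by move/lefP : (nd_nnsfun_approx measurableT mW' nm); apply.
  have phi0 n w : 0 <= phi n w by [].
  (* A simple function is a finite combination of indicators of its level sets, and these lie in the
     sub-sigma-field. *)
  have exphi n : Ex (fun w => phi n w * D w) = 0.
    have fin : finite_set (range (phi n)) by exact: fimfunP.
    have mA y : <<s G >> (phi n @^-1` [set y]).
      by rewrite -[_ @^-1` _]setTI; apply: (mphi n).
    pose s := [seq (y, fun w => \1_(phi n @^-1` [set y]) w * D w) |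
      y <- finmap.enum_fset (fset_set (range (phi n)))].
    rewrite (Ex_lin P s).
    - rewrite big_map big1// => y _ /=.
      by rewrite D0 ?mulr0.
    - move=> w; rewrite big_map {1}(fimfunE (phi n) w) fsbig_finite//= mulr_suml.
      by apply: eq_bigr => y _; rewrite mulrA.
    - rewrite /s; elim: (X in map _ X) => //= y r IH; split => //.
      by apply: integ_indic => //; exact/GT.
  have : ((fun n => \int[P]_w (phi n w * D w)%:E) @ \oo --> \int[P]_w (W' w * D w)%:E)%E.
    have [] := @dominated_convergence _ T R P setT measurableT
      (fun n w => (phi n w * D w)%:E) (fun w => (W' w * D w)%:E)
      (fun w => `|W' w * D w|%:E).
    - move=> n; apply/measurable_EFinP; apply: measurable_funM.
        exact: gmfun_mfun.
      exact: (integ_mfun P).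
    - by apply/measurable_EFinP; exact: (integ_mfun P).
    - apply: aeW => w _.
      have : (((EFin \o phi ^~ w) n * (D w)%:E)%E @[n --> \oo] -->
          ((W' w)%:E * (D w)%:E)%E) by apply: cvgeZr => //; exact: phicvg.
      exact.
    - exact: (integ_norm P).
    - apply: aeW => w n _ /=; rewrite lee_fin !normrM ler_wpM2r//.
      by rewrite !ger0_norm.
    - by [].
  under eq_fun.
    move=> n; rewrite -(EFin_Ex P) ?exphi; last first.
      apply: (le_integ P _ _ _ _ iWD).
        by apply: measurable_funM; [exact: gmfun_mfun|exact: (integ_mfun P)].
      by move=> w; rewrite !normrM ler_wpM2r// !ger0_norm.
    over.
  move=> h0.
  rewrite /expect /Rintegral.
  have := cvg_unique _ h0 (cvg_cst 0%E).
  by move=> ->.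
move=> mW iWD.
have mP : gmfun G (W^\+) by exact: measurable_funrpos.
have mN : gmfun G (W^\-) by exact: measurable_funrneg.
have mD : measurable_fun setT D by exact: (integ_mfun P).
have iP : integ (fun w => W^\+ w * D w).
  apply: (le_integ P _ _ _ _ iWD).
    by apply: measurable_funM => //; exact: gmfun_mfun.
  move=> w; rewrite !normrM ler_wpM2r//.
  rewrite /funrpos; case: (lerP 0 (W w)) => // _.
  by rewrite normr0.
have iN : integ (fun w => W^\- w * D w).
  apply: (le_integ P _ _ _ _ iWD).
    by apply: measurable_funM => //; exact: gmfun_mfun.
  move=> w; rewrite !normrM ler_wpM2r//.
  rewrite /funrneg; case: (lerP 0 (- W w)) => // _; last by rewrite normr0.
  by rewrite normrN.
rewrite (eq_Ex P _ (fun w => W^\+ w * D w - W^\- w * D w)); last first.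
  move=> w; rewrite -mulrBl; congr (_ * _).
  by rewrite /funrpos /funrneg; case: lerP => h1; case: lerP => h2; lra.
by rewrite (ExB P)// !nonneg ?subr0.
Qed.

Lemma cond_exp_integ Z Y : is_cond_exp P <<s G>> Z Y -> integ Z /\ integ Y.
Proof. by case. Qed.

Lemma cond_exp_gmfun Z Y : is_cond_exp P <<s G>> Z Y -> gmfun G Y.
Proof. by case=> _ _ mY _; exact/gmfun_preimage. Qed.

Lemma cond_exp_indic Z Y A : is_cond_exp P <<s G>> Z Y -> <<s G>> A ->
  Ex (fun w => \1_A w * Y w) = Ex (fun w => \1_A w * Z w).
Proof.
case=> _ _ _ h GA; rewrite !(Ex_indic P); try exact: GT.
by rewrite /Rintegral h.
Qed.

Lemma cond_expI Z Y : integ Z -> integ Y -> gmfun G Y ->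
  (forall A, <<s G>> A -> Ex (fun w => \1_A w * Y w) = Ex (fun w => \1_A w * Z w)) ->
  is_cond_exp P <<s G>> Z Y.
Proof.
move=> iZ iY mY h; split => //; first exact/gmfun_preimage.
move=> A GA; have mA := GT _ GA.
have fin f : integ f -> (\int[P]_(w in A) (f w)%:E)%E \is a fin_num.
  by move=> fi; apply: integrable_fin_num => //; apply: integrableS fi.
have := h A GA; rewrite !(Ex_indic P)// /Rintegral => E.
by rewrite -[LHS]fineK ?fin// -[RHS]fineK ?fin// E.
Qed.

Lemma Ex_test Z Y W : is_cond_exp P <<s G>> Z Y -> gmfun G W ->
  integ (fun w => W w * Z w) -> integ (fun w => W w * Y w) ->
  Ex (fun w => W w * Z w) = Ex (fun w => W w * Y w).
Proof.
move=> ZY mW iWZ iWY; have [iZ iY] := cond_exp_integ _ _ ZY.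
apply/eqP; rewrite -subr_eq0 -(ExB P)//; apply/eqP.
rewrite (eq_Ex P _ (fun w => W w * (Z w - Y w))); last by move=> w; rewrite mulrBr.
apply: Ex_test0 => //.
- exact: integB.
- move=> A GA.
  rewrite (eq_Ex P _ (fun w => \1_A w * Z w - \1_A w * Y w)); last first.
    by move=> w; rewrite mulrBr.
  rewrite (ExB P); try by apply: integ_indic => //; exact: GT.
  by rewrite (cond_exp_indic Z Y)// subrr.
- apply: (eq_integ P (fun w => W w * Z w - W w * Y w)).
    by move=> w; rewrite mulrBr.
  exact: integB.
Qed.

(** Integrability is transferred from the conditional expectation Y back to Z: for W cut at n,
    E(min(W, n) Z) = E(min(W, n) Y) <= E|W Y|, uniformly in n. *)
Lemma integ_test Z Y W : is_cond_exp P <<s G>> Z Y -> gmfun G W ->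
  (forall w, 0 <= W w) -> (forall w, 0 <= Z w) ->
  integ (fun w => W w * Y w) -> integ (fun w => W w * Z w).
Proof.
move=> ZY mW W0 Z0 iWY; have [iZ iY] := cond_exp_integ _ _ ZY.
have mmin n : gmfun G (fun w => Num.min (W w) n%:R).
  by rewrite /gmfun; apply: measurable_minr => //; exact: measurable_cst.
have bmin n w : `|Num.min (W w) n%:R| <= n%:R.
  by rewrite ger0_norm ?le_min ?W0 ?ler0n// ge_min lexx orbT.
have mint n f : integ f -> integ (fun w => Num.min (W w) n%:R * f w).
  move=> fi; apply: (le_integ P _ (fun w => n%:R * f w)).
  - by apply: measurable_funM; [exact: gmfun_mfun|exact: (integ_mfun P)].
  - by move=> w; rewrite !normrM ler_wpM2r// (le_trans (bmin n w))// ler_norm.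
  - exact: integZ.
apply: (integ_truncated P (Ex (fun w => `|W w * Y w|))) => //.
- exact: gmfun_mfun.
- exact: (integ_mfun P).
- by move=> n; exact: mint.
- move=> n; rewrite (Ex_test _ _ _ ZY); try exact: mint; last exact: mmin.
  apply: le_Ex; [exact: mint|exact: integ_norm|].
  move=> w; rewrite (le_trans (ler_norm _))// !normrM ler_wpM2r//.
  rewrite !ger0_norm//; first by rewrite ge_min lexx.
  by rewrite le_min W0 ler0n.
Qed.

Lemma cond_exp_unique Z Y1 Y2 : is_cond_exp P <<s G>> Z Y1 ->
  is_cond_exp P <<s G>> Z Y2 -> {ae P, forall w, Y1 w = Y2 w}.
Proof.
move=> ZY1 ZY2.
have [_ i1] := cond_exp_integ _ _ ZY1; have [_ i2] := cond_exp_integ _ _ ZY2.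
have m1 := cond_exp_gmfun _ _ ZY1; have m2 := cond_exp_gmfun _ _ ZY2.
pose D w := Y1 w - Y2 w.
have iD : integ D by exact: integB.
(* The difference D has a constant sign on A and on its complement, both in the sub-sigma-field;
   testing on each gives E|D| = 0. *)
pose A := [set w | Y2 w <= Y1 w].
have GA : <<s G>> A.
  rewrite (_ : A = (fun w => Y2 w <= Y1 w) @^-1` [set true]).
    rewrite -[_ @^-1` _]setTI.
    by apply: (measurable_fun_ler (m2 : measurable_fun (setT : set (g_sigma_algebraType G)) _) m1).
  by apply/seteqP; split=> w /=.
have GC : <<s G>> (~` A) by exact: (sigma_algebraC GA).
have D0 B : <<s G>> B -> Ex (fun w => \1_B w * D w) = 0.
  move=> GB; rewrite (eq_Ex P _ (fun w => \1_B w * Y1 w - \1_B w * Y2 w)); last first.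
    by move=> w; rewrite -mulrBr.
  rewrite (ExB P); try by apply: integ_indic => //; exact: GT.
  by rewrite (cond_exp_indic Z Y1)// (cond_exp_indic Z Y2)// subrr.
have abs0 : Ex (fun w => `|D w|) = 0.
  rewrite (eq_Ex P _ (fun w => \1_A w * D w - \1_(~` A) w * D w)); last first.
    move=> w; rewrite !indicE in_setC; have [h|h] /= := boolP (w \in A).
      by rewrite mul1r mul0r subr0 ger0_norm// subr_ge0; exact: (set_mem h).
    rewrite mul0r mul1r sub0r ler0_norm// subr_le0.
    by rewrite ltW// ltNge; apply/negP => /mem_set; exact/negP.
  by rewrite (ExB P) ?D0 ?subrr//; apply: integ_indic => //; exact: GT.
have mD : measurable_fun setT (EFin \o D) by apply/measurable_EFinP; exact: (integ_mfun P).
have : ae_eq P setT (EFin \o D) (cst 0%E).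
  apply/(ae_eq_integral_abs P measurableT mD).
  transitivity (Ex (fun w => `|D w|))%:E; last by rewrite abs0.
  by rewrite (EFin_Ex P _ (integ_norm P _ iD)).
apply: filterS => w /(_ I) h; apply/eqP; rewrite -subr_eq0; apply/eqP.
exact: (EFin_inj h).
Qed.

(** [is_cond_var] hides some versions M and S of the conditional moments and fixes V only almost
    surely. Uniqueness replaces M by the given Y; the measurability of V then makes V + Y^2 itself a
    version of E[Z^2 | G]. *)
Lemma cond_second_moment Z Y V : is_cond_exp P <<s G>> Z Y ->
  is_cond_var P <<s G>> Z V -> gmfun G V ->
  is_cond_exp P <<s G>> (fun w => Z w ^+ 2) (fun w => V w + Y w ^+ 2).
Proof.
move=> ZY [M [S [ZM ZS VE]]] mV.
have [iZ2 iS] := cond_exp_integ _ _ ZS.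
have mY := cond_exp_gmfun _ _ ZY.
have mU : gmfun G (fun w => V w + Y w ^+ 2).
  by apply: (measurable_funD mV); exact: (measurable_funX 2 mY).
have SE : {ae P, forall w, S w = V w + Y w ^+ 2}.
  have := cond_exp_unique _ _ _ ZM ZY.
  move: VE; apply: filterS2 => w -> ->; by rewrite subrK.
have mS : measurable_fun setT S by exact: (integ_mfun P).
have mU' := gmfun_mfun _ mU.
split => //.
- apply/integrableP; split; first exact/measurable_EFinP.
  rewrite -(_ : \int[P]_w `|(EFin \o S) w| =
    \int[P]_w `|(EFin \o (fun w => V w + Y w ^+ 2)%R) w|)%E.
    by case/integrableP : iS.
  apply: ae_eq_integral => //.
  + by apply: measurableT_comp => //; exact/measurable_EFinP.
  + by apply: measurableT_comp => //; exact/measurable_EFinP.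
  + by move: SE; apply: filterS => w h _ /=; rewrite h.
- exact/gmfun_preimage.
- move=> A GA; case: (ZS) => _ _ _ <- //; have mA := GT _ GA.
  apply: ae_eq_integral => //.
  + by apply/measurable_EFinP; exact: measurable_funTS.
  + by apply/measurable_EFinP; exact: measurable_funTS.
  + by move: SE; apply: filterS => w h _ /=; rewrite h.
Qed.

End conditional_expectation.

(** * Square-integrable variables and the Cauchy-Schwarz inequality *)

Section square_integrable.
Context {d : measure_display} {T : measurableType d} {R : realType}.
Variable P : probability T R.
Implicit Types W f g : T -> R.
Local Notation integ := (integ P).
Local Notation Ex := (expect P).

Definition sqint f := measurable_fun setT f /\ integ (fun w => f w ^+ 2).

Lemma sqint_mul f g : sqint f -> sqint g -> integ (fun w => f w * g w).
Proof.
move=> [mf fi] [mg gi].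
apply: (le_integ P _ (fun w => f w ^+ 2 + g w ^+ 2)).
- exact: measurable_funM.
- move=> w; rewrite [leRHS]ger0_norm ?addr_ge0 ?sqr_ge0//.
  rewrite ler_norml; apply/andP; split; nra.
- exact: integD.
Qed.

Lemma sqint_cst c : sqint (fun=> c).
Proof. by split; [exact: measurable_cst|exact: integ_cst]. Qed.

Lemma sqint_integ f : sqint f -> integ f.
Proof.
move=> sf; apply: (eq_integ P (fun w => 1 * f w)); first by move=> w; rewrite mul1r.
exact: (sqint_mul _ _ (sqint_cst 1) sf).
Qed.

Lemma sqint_bounded (M : R) W f : measurable_fun setT W ->
  (forall w, `|W w| <= M) -> sqint f -> sqint (fun w => W w * f w).
Proof.
move=> mW WM [mf fi]; split; first exact: measurable_funM.
apply: (le_integ P _ (fun w => M ^+ 2 * f w ^+ 2)).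
- by apply: measurable_funX; exact: measurable_funM.
- move=> w /=; rewrite -exprMn !normrX lerXn2r ?nnegrE//.
  by rewrite !normrM ler_wpM2r// (le_trans (WM w))// ler_norm.
- exact: integZ.
Qed.

Lemma cauchy_schwarz f g : sqint f -> sqint g ->
  0 < Ex (fun w => g w ^+ 2) ->
  Ex (fun w => f w * g w) ^+ 2 <= Ex (fun w => f w ^+ 2) * Ex (fun w => g w ^+ 2).
Proof.
move=> sf sg; set a := Ex (fun w => g w ^+ 2) => a0.
set b := Ex (fun w => f w * g w); set c := Ex _.
have : 0 <= Ex (fun w => (a * f w - b * g w) ^+ 2) by apply: Ex_ge0 => w; exact: sqr_ge0.
rewrite (Ex_lin P [:: (a ^+ 2, fun w => f w ^+ 2); (- 2 * a * b, fun w => f w * g w);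
  (b ^+ 2, fun w => g w ^+ 2)]).
- rewrite !big_cons big_nil /= -/a -/b -/c => h.
  have : 0 <= a * (c * a - b ^+ 2) by lra.
  by rewrite pmulr_rge0// subr_ge0.
- by move=> w; rewrite !big_cons big_nil /=; ring.
- by move: sf sg => [mf fi] [mg gi]; do !split => //; exact: sqint_mul.
Qed.

End square_integrable.

(** * Affine functions whose square is bounded by a linear one *)

Section growth.
Context {R : realType}.

Lemma slope_eq0 (a k C t0 : R) :
  (forall u, t0 < u -> (a + k * u) ^+ 2 <= C * u) -> k = 0.
Proof.
move=> h; apply/eqP; apply: contraT => k0.
have k2 : 0 < k ^+ 2 by rewrite exprn_even_gt0.
(* From (2a + ku)^2 >= 0 one gets (ku)^2 <= 2 (a + ku)^2 + 2 a^2, which is at most B u for u >= 1.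
   Hence k^2 u <= B, and u is chosen just beyond B / k^2. *)
pose B := 2 * (a ^+ 2 + `|C|).
have B0 : 0 <= B by rewrite mulr_ge0// addr_ge0// sqr_ge0.
pose u := `|t0| + 1 + B / k ^+ 2.
have Bk : 0 <= B / k ^+ 2 by rewrite divr_ge0// ltW.
have t0u : t0 < u by rewrite /u; have := ler_norm t0; lra.
have u1 : 1 <= u by rewrite /u; have := normr_ge0 t0; lra.
have hu := h u t0u.
have hC : C * u <= `|C| * u by rewrite ler_wpM2r ?ler_norm//; lra.
have k2u : k ^+ 2 * u <= B.
  have a2u : 0 <= a ^+ 2 * (u - 1) by rewrite mulr_ge0 ?sqr_ge0 ?subr_ge0.
  have ku : (k ^+ 2 * u) * u <= B * u.
    by have := sqr_ge0 (2 * a + k * u); rewrite /B; lra.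
  by rewrite -(ler_pM2r (x := u))//; lra.
have : B < k ^+ 2 * u.
  rewrite /u mulrDr mulrCA divff ?gt_eqF// mulr1.
  by rewrite ltrDr mulr_gt0//; have := normr_ge0 t0; lra.
lra.
Qed.

Lemma intercept_eq0 (a k C t0 : R) : 0 < t0 ->
  (forall s, 0 < s -> s < t0 -> (a + k * s) ^+ 2 <= C * s) -> a = 0.
Proof.
move=> t00 h; apply/eqP; apply: contraT => a0.
have a2 : 0 < a ^+ 2 by rewrite exprn_even_gt0.
(* From (a + 2ks)^2 >= 0 one gets a^2 <= 2 (a + ks)^2 + 2 (ks)^2, which is at most 2 (|C| + k^2) s
   for s <= 1. The choice s <= a^2 / (4B) pushes this below a^2; the summand 1 keeps B positive. *)
pose B := `|C| + k ^+ 2 + 1.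
have B0 : 0 < B by rewrite ltr_wpDl// addr_ge0// sqr_ge0.
pose s := Num.min (t0 / 2) (Num.min 1 (a ^+ 2 / (4 * B))).
have s0 : 0 < s by rewrite !lt_min ltr01 !divr_gt0// mulr_gt0.
have st0 : s < t0 by rewrite gt_min; apply/orP; left; lra.
have s1 : s <= 1 by rewrite !ge_min lexx orbT.
have sB : s * (4 * B) <= a ^+ 2.
  by rewrite -ler_pdivlMr ?mulr_gt0// !ge_min lexx !orbT.
have hs := h s s0 st0.
have hC : C * s <= `|C| * s by rewrite ler_wpM2r ?ler_norm//; lra.
have k2 : 0 <= k ^+ 2 by exact: sqr_ge0.
have k3 : k ^+ 2 * s ^+ 2 <= k ^+ 2 * s by rewrite ler_wpM2l// expr2; nra.
have := sqr_ge0 (a + 2 * (k * s)).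
rewrite /B in sB; lra.
Qed.

End growth.

(** * One-sided conditional moments of a harness *)

Section adapted.
Context {d : measure_display} {T : measurableType d} {R : realType}.
Context {P : probability T R}.
Variable X : R -> {RV P >-> R}.
Implicit Types (W f g : T -> R) (I : set R).

(** Isolated from [sigma_of] because the lemmas on conditional expectations are stated for
    [<<s G>>]; [past] and [two_sided] unfold to this form. *)
Definition generators I : set (set T) :=
  \bigcup_(t in I) preimage_set_system setT (X t) measurable.

Definition adapted I W := gmfun (generators I) W.

Lemma generated_measurable I : <<s generators I>> `<=` measurable.
Proof.
apply: smallest_sub; first exact: sigma_algebra_measurable.
move=> A [t _ [B mB <-]]; exact: (measurable_funPT (X t)).
Qed.

Lemma adapted_mfun I W : adapted I W -> measurable_fun setT W.
Proof. by apply: gmfun_mfun; exact: generated_measurable. Qed.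

Lemma adapted_X I t : I t -> adapted I (X t).
Proof.
move=> It; apply/gmfun_preimage => A hA.
by apply: sub_sigma_algebra; exists t.
Qed.

Lemma sigma_of_subset I I' : I `<=` I' -> <<s generators I>> `<=` <<s generators I'>>.
Proof.
move=> II'; apply: smallest_sub; first exact: smallest_sigma_algebra.
by move=> A [t It At]; apply: sub_sigma_algebra; exists t => //; exact: II'.
Qed.

Lemma adapted_subset I I' W : I `<=` I' -> adapted I W -> adapted I' W.
Proof.
move=> II' /gmfun_preimage mW; apply/gmfun_preimage.
by apply: subset_trans mW _; exact: sigma_of_subset.
Qed.

Lemma adaptedD I f g : adapted I f -> adapted I g -> adapted I (fun w => f w + g w).
Proof. by move=> mf mg; apply: (measurable_funD mf mg). Qed.

Lemma adaptedM I f g : adapted I f -> adapted I g -> adapted I (fun w => f w * g w).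
Proof. by move=> mf mg; apply: (measurable_funM mf mg). Qed.

Lemma adapted_cst I c : adapted I (fun=> c).
Proof. exact: measurable_cst. Qed.

Lemma adapted_comp I (h : R -> R) f : measurable_fun setT h -> adapted I f ->
  adapted I (fun w => h (f w)).
Proof. by move=> mh mf; apply: (measurableT_comp mh mf). Qed.

End adapted.

Section harness.
Context {d : measure_display} {T : measurableType d} {R : realType}.
Context {P : probability T R}.
Variable X : R -> {RV P >-> R}.
Variables q eta theta tau : R.
Hypothesis XH : quadratic_harness X q eta theta 0 tau.
Hypothesis q1 : q <= 1.
Implicit Types (W f g : T -> R).
Local Notation integ := (integ P).
Local Notation Ex := (expect P).
Local Notation sqint := (sqint P).

Lemma tau_ge0 : 0 <= tau. Proof. by case: XH. Qed.

Lemma den_neq0 s u : 0 < s -> s < u -> u + tau - q * s != 0.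
Proof.
move=> s0 su; rewrite gt_eqF//; have qs : q * s <= s by rewrite ler_piMl// ltW.
by have := tau_ge0; lra.
Qed.

Lemma mX t : measurable_fun setT (X t : T -> R).
Proof. exact: measurable_funPT. Qed.

Lemma sqint_X t : 0 < t -> sqint (X t).
Proof.
move=> t0; split; first exact: mX.
by apply: Lfun2_integrable_sqr; exact: (qh_square_integrable XH).
Qed.

Lemma Ex_X t : 0 < t -> Ex (X t) = 0.
Proof.
move=> t0; have := qh_mean XH t0; rewrite unlock.
by rewrite -(EFin_Ex P); [case|exact: sqint_integ (sqint_X t t0)].
Qed.

Lemma Ex_X2 t : 0 < t -> Ex (fun w => X t w ^+ 2) = t.
Proof.
move=> t0; have := qh_cov XH t0 t0; rewrite unlock minxx.
rewrite -(EFin_Ex P); first by case.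
exact: (sqint_mul P _ _ (sqint_X t t0) (sqint_X t t0)).
Qed.

Lemma harness_mean s t u W : 0 < s -> s < t -> t < u ->
  adapted X (`]0, s] `|` `[u, +oo[) W -> sqint W ->
  Ex (fun w => W w * X t w) =
  (u - t) / (u - s) * Ex (fun w => W w * X s w)
  + (t - s) / (u - s) * Ex (fun w => W w * X u w).
Proof.
move=> s0 st tu aW sW.
have t0 := lt_trans s0 st; have u0 := lt_trans t0 tu.
have is_ := sqint_mul P _ _ sW (sqint_X s s0).
have iu := sqint_mul P _ _ sW (sqint_X u u0).
have it := sqint_mul P _ _ sW (sqint_X t t0).
have E w : W w * ((u - t) / (u - s) * X s w + (t - s) / (u - s) * X u w) =
  \sum_(c <- [:: ((u - t) / (u - s), fun w => W w * X s w);
    ((t - s) / (u - s), fun w => W w * X u w)]) c.1 * c.2 w.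
  by rewrite !big_cons big_nil /=; ring.
rewrite (Ex_test P _ (generated_measurable X _) _ _ _ (qh_cond_mean XH s0 st tu))//.
- by rewrite (Ex_lin P _ _ E)// !big_cons big_nil addr0.
- exact: (integ_lin P _ _ E).
Qed.

(** Integrability of W times the squares is assumed rather than derived, so that the identity serves
    bounded W, before higher moments are known, as well as W p_m(X_u; u) afterwards. *)
Lemma harness_second_moment s t u W : 0 < s -> s < t -> t < u ->
  adapted X (`]0, s] `|` `[u, +oo[) W ->
  integ W -> integ (fun w => W w * X s w ^+ 2) ->
  integ (fun w => W w * X t w ^+ 2) -> integ (fun w => W w * X u w ^+ 2) ->
  let ss := Ex (fun w => W w * X s w ^+ 2) in
  let su := Ex (fun w => W w * X s w * X u w) in
  let uu := Ex (fun w => W w * X u w ^+ 2) in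
  let s1 := Ex (fun w => W w * X s w) in
  let u1 := Ex (fun w => W w * X u w) in
  Ex (fun w => W w * X t w ^+ 2) =
  ((u - t) ^+ 2 * ss + 2 * (u - t) * (t - s) * su + (t - s) ^+ 2 * uu) / (u - s) ^+ 2
  + (u - t) * (t - s) / (u + tau - q * s) *
   (Ex W + eta * ((u * s1 - s * u1) / (u - s)) + theta * ((u1 - s1) / (u - s))
    + tau * ((uu - 2 * su + ss) / (u - s) ^+ 2)
    - (1 - q) * ((u * su - s * uu - u * ss + s * su) / (u - s) ^+ 2)).
Proof.
move=> s0 st tu aW iW iWs iWt iWu ss su uu s1 u1.
have t0 := lt_trans s0 st; have u0 := lt_trans t0 tu.
have us0 : u - s != 0 by rewrite subr_eq0 gt_eqF// (lt_trans st).
have de0 : u + tau - q * s != 0 by apply: den_neq0 => //; exact: lt_trans tu.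
have mW : measurable_fun setT W by exact: adapted_mfun aW.
have dom f g : measurable_fun setT f -> (forall w, `|f w| <= 1 + g w ^+ 2) ->
    integ (fun w => W w * g w ^+ 2) -> integ (fun w => W w * f w).
  move=> mf fg ig; apply: (le_integ P _ (fun w => `|W w| + `|W w * g w ^+ 2|)).
  - exact: measurable_funM.
  - move=> w; rewrite normrM [leRHS]ger0_norm ?addr_ge0// normrM.
    rewrite (ger0_norm (sqr_ge0 _)) -[X in X + _]mulr1 -mulrDr.
    by rewrite ler_wpM2l.
  - by apply: integD; exact: integ_norm.
have is1 : integ (fun w => W w * X s w).
  apply: (dom _ _ (mX s) _ iWs) => w; rewrite ler_norml; apply/andP; split; nra.
have iu1 : integ (fun w => W w * X u w).
  apply: (dom _ _ (mX u) _ iWu) => w; rewrite ler_norml; apply/andP; split; nra.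
have isu : integ (fun w => W w * X s w * X u w).
  apply: (le_integ P _ (fun w => `|W w * X s w ^+ 2| + `|W w * X u w ^+ 2|)).
  - by apply: measurable_funM; [apply: measurable_funM => //|]; exact: mX.
  - move=> w; rewrite [leRHS]ger0_norm ?addr_ge0// -mulrA !normrM.
    rewrite -mulrDr ler_wpM2l//.
    have := sqr_ge0 (`|X s w| - `|X u w|); have := normr_ge0 (X s w).
    have := normr_ge0 (X u w); nra.
  - by apply: integD; exact: integ_norm.
(* The factors 0 are kept so that V is literally the variance of [qh_cond_var] at sigma = 0. *)
pose V w := (u - t) * (t - s) / (u * (1 + 0 * s) + tau - q * s) *
        (1 + eta * tDelta X s u w + theta * Delta X s u w
         + 0 * tDelta X s u w ^+ 2 + tau * Delta X s u w ^+ 2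
         - (1 - q) * Delta X s u w * tDelta X s u w).
have Is : (`]0, s] `|` `[u, +oo[) s by left; rewrite /= in_itv/= s0 lexx.
have Iu : (`]0, s] `|` `[u, +oo[) u by right; rewrite /= in_itv/= lexx.
have aX r : (`]0, s] `|` `[u, +oo[) r -> adapted X (`]0, s] `|` `[u, +oo[) (X r).
  exact: adapted_X.
pose K := (u - t) * (t - s) / (u + tau - q * s).
have VE w : V w =
    K * (1 + (eta * u - theta) / (u - s) * X s w + (theta - eta * s) / (u - s) * X u w
     + (tau + (1 - q) * u) / (u - s) ^+ 2 * (X s w * X s w)
     + (tau + (1 - q) * s) / (u - s) ^+ 2 * (X u w * X u w)
     + - (2 * tau + (1 - q) * (u + s)) / (u - s) ^+ 2 * (X s w * X u w)).
  by rewrite /V /K /Delta /tDelta; field; rewrite us0 ?mul0r ?addr0 ?mulr1 de0.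
have aV : adapted X (`]0, s] `|` `[u, +oo[) V.
  have ac c f : adapted X (`]0, s] `|` `[u, +oo[) f ->
     adapted X (`]0, s] `|` `[u, +oo[) (fun w => c * f w).
    by move=> af; apply: adaptedM => //; exact: adapted_cst.
  have -> : V = _ := funext VE.
  by do ?[exact: adapted_cst | exact: aX | apply: adaptedD | apply: ac | apply: adaptedM].
have cm := cond_second_moment P _ (generated_measurable X _) _ _ _
  (qh_cond_mean XH s0 st tu) (qh_cond_var XH s0 st tu) aV.
pose l := [:: (K, W); (K * ((eta * u - theta) / (u - s)), fun w => W w * X s w);
   (K * ((theta - eta * s) / (u - s)), fun w => W w * X u w);
   (K * ((tau + (1 - q) * u) / (u - s) ^+ 2) + ((u - t) / (u - s)) ^+ 2, fun w => W w * X s w ^+ 2);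
   (K * ((tau + (1 - q) * s) / (u - s) ^+ 2) + ((t - s) / (u - s)) ^+ 2, fun w => W w * X u w ^+ 2);
   (K * (- (2 * tau + (1 - q) * (u + s)) / (u - s) ^+ 2) + 2 * ((u - t) / (u - s)) * ((t - s) / (u - s)),
     fun w => W w * X s w * X u w)].
have E w : W w * (V w + ((u - t) / (u - s) * X s w + (t - s) / (u - s) * X u w) ^+ 2) =
    \sum_(c <- l) c.1 * c.2 w.
  by rewrite /l !big_cons big_nil /= VE; ring.
have il : foldr (fun c Q => integ c.2 /\ Q) True l by [].
rewrite (Ex_test P _ (generated_measurable X _) _ _ _ cm aW iWt (integ_lin P _ _ E il)).
rewrite (Ex_lin P _ _ E il) /l !big_cons big_nil /= -/ss -/su -/uu -/s1 -/u1 /K.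
by field; rewrite us0 de0.
Qed.

Lemma past_two_sided s u : `]0, s] `<=` `]0, s] `|` (`[u, +oo[ : set R).
Proof. by move=> x; left. Qed.

Lemma future_two_sided s u : `[u, +oo[ `<=` `]0, s] `|` (`[u, +oo[ : set R).
Proof. by move=> x; right. Qed.

Lemma past_subset (s t : R) : s <= t -> `]0, s] `<=` (`]0, t] : set R).
Proof. by move=> st x /=; rewrite !in_itv/= => /andP[-> /le_trans]; apply. Qed.

Lemma future_subset (s t : R) : s <= t -> `[t, +oo[ `<=` (`[s, +oo[ : set R).
Proof. by move=> st x /=; rewrite !in_itv/= !andbT; exact: le_trans. Qed.

(* [r |-> E(W X_r)] is affine for [r >= s] and O(sqrt r), hence constant. *)
Lemma past_mean s t W : 0 < s -> s <= t -> adapted X `]0, s] W -> sqint W ->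
  Ex (fun w => W w * X t w) = Ex (fun w => W w * X s w).
Proof.
move=> s0; rewrite le_eqVlt => /predU1P[->//|st] aW sW.
pose f u := Ex (fun w => W w * X u w); rewrite -/(f t) -/(f s).
have ft u : t < u -> f t = (u - t) / (u - s) * f s + (t - s) / (u - s) * f u.
  move=> tu; apply: harness_mean => //.
  by apply: adapted_subset aW; exact: past_two_sided.
have ts0 : t - s != 0 by rewrite subr_eq0 gt_eqF.
pose k := (f t - f s) / (t - s).
suff /eqP : k = 0.
  by rewrite mulf_eq0 invr_eq0 (negPf ts0) orbF subr_eq0 => /eqP.
apply: (slope_eq0 (f s - k * s) k (Ex (fun w => W w ^+ 2)) t) => u tu.
have u0 : 0 < u by rewrite (lt_trans s0)// (lt_trans st).
have us0 : u - s != 0 by rewrite subr_eq0 gt_eqF// (lt_trans st).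
rewrite (_ : f s - k * s + k * u = f u).
  rewrite -{2}(Ex_X2 u u0); apply: (cauchy_schwarz P _ _ sW (sqint_X u u0)).
  by rewrite Ex_X2.
rewrite /k (ft u tu); field.
by rewrite us0 ts0.
Qed.

(* [r |-> E(W X_r)] is affine for [r <= u] and O(sqrt r) at 0, hence linear. *)
Lemma future_mean t u W : 0 < t -> t <= u -> adapted X `[u, +oo[ W -> sqint W ->
  Ex (fun w => W w * X t w) = t / u * Ex (fun w => W w * X u w).
Proof.
move=> t0; rewrite le_eqVlt => /predU1P[<-|tu] aW sW.
  by rewrite divff ?gt_eqF// mul1r.
have u0 := lt_trans t0 tu.
pose f u := Ex (fun w => W w * X u w); rewrite -/(f t) -/(f u).
have ft s : 0 < s -> s < t -> f t = (u - t) / (u - s) * f s + (t - s) / (u - s) * f u.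
  move=> s0 st; apply: harness_mean => //.
  by apply: adapted_subset aW; exact: future_two_sided.
have ut0 : u - t != 0 by rewrite subr_eq0 gt_eqF.
pose a := (u * f t - t * f u) / (u - t).
have a0 : a = 0.
  apply: (intercept_eq0 a ((f u - f t) / (u - t)) (Ex (fun w => W w ^+ 2)) t) => // s s0 st.
  have us0 : u - s != 0 by rewrite subr_eq0 gt_eqF// (lt_trans st).
  rewrite (_ : _ + _ = f s).
    rewrite -{2}(Ex_X2 s s0); apply: (cauchy_schwarz P _ _ sW (sqint_X s s0)).
    by rewrite Ex_X2.
  by rewrite /a (ft s s0 st); field; rewrite us0 ut0.
have : u * f t - t * f u = 0.
  by move/eqP : a0; rewrite mulf_eq0 invr_eq0 (negPf ut0) orbF => /eqP.
move=> E; have u00 : u != 0 by rewrite gt_eqF.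
apply: (mulfI u00); rewrite mulrA mulrCA divff// mulr1; lra.
Qed.

(* No limit is needed: [E(W X_t X_u)] computed by conditioning on the past of [t]
   and on F_{s,u} gives a second linear equation besides the conditional variance. *)
Lemma past_second_moment s t (M : R) W : 0 < s -> s < t ->
  adapted X `]0, s] W -> (forall w, `|W w| <= M) ->
  Ex (fun w => W w * X t w ^+ 2) =
  Ex (fun w => W w * X s w ^+ 2) + (t - s) * (Ex W + eta * Ex (fun w => W w * X s w)).
Proof.
move=> s0 st aW WM; have t0 := lt_trans s0 st.
pose u := t + 1; have tu : t < u by rewrite /u; lra.
have u0 := lt_trans t0 tu; have su := lt_trans st tu.
have mW : measurable_fun setT W by exact: adapted_mfun aW.
have sW : sqint W.
  apply: (_ : sqint (fun w => W w)).
  have [m i] := sqint_bounded P M W (fun=> 1) mW WM (sqint_cst P 1).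
  by split=> //; apply: eq_integ i => w; rewrite mulr1.
have sWX r : 0 < r -> sqint (fun w => W w * X r w).
  by move=> r0; exact: (sqint_bounded P M _ _ mW WM (sqint_X r r0)).
have iWX2 r : 0 < r -> integ (fun w => W w * X r w ^+ 2).
  move=> r0; apply: eq_integ (sqint_mul P _ _ (sWX r r0) (sqint_X r r0)) => w.
  by rewrite -mulrA -expr2.
have X2E r r' : Ex (fun w => W w * X r w * X r' w) = Ex (fun w => W w * X r' w * X r w).
  by apply: eq_Ex => w; ring.
have X2s r : Ex (fun w => W w * X r w * X r w) = Ex (fun w => W w * X r w ^+ 2).
  by apply: eq_Ex => w; rewrite -mulrA -expr2.
have aXs : adapted X `]0, s] (X s) by apply: adapted_X; rewrite /= in_itv/= s0 lexx.
have aXt : adapted X `]0, t] (X t) by apply: adapted_X; rewrite /= in_itv/= t0 lexx.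
have aXu : adapted X `[u, +oo[ (X u) by apply: adapted_X; rewrite /= in_itv/= lexx.
have aWt : adapted X `]0, t] W by apply: adapted_subset aW; apply: past_subset; exact: ltW.
have aWsu : adapted X (`]0, s] `|` `[u, +oo[) W.
  by apply: adapted_subset aW; exact: past_two_sided.
have Eu1 : Ex (fun w => W w * X u w) = Ex (fun w => W w * X s w).
  by apply: past_mean => //; exact: ltW.
have Esu : Ex (fun w => W w * X s w * X u w) = Ex (fun w => W w * X s w ^+ 2).
  by rewrite (past_mean s u) ?X2s//; [exact: ltW|exact: adaptedM|exact: sWX].
have Etu : Ex (fun w => W w * X t w * X u w) = Ex (fun w => W w * X t w ^+ 2).
  by rewrite (past_mean t u) ?X2s//; [exact: ltW|exact: adaptedM|exact: sWX].
have := harness_mean s t u (fun w => W w * X u w) s0 st tu.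
rewrite X2E Etu X2E Esu X2s => /(_ _ (sWX u u0)) E1.
have {}E1 := E1 (adaptedM X _ _ _ aWsu (adapted_subset X _ _ _ (future_two_sided s u) aXu)).
have := harness_second_moment s t u W s0 st tu aWsu (sqint_integ P _ sW)
  (iWX2 s s0) (iWX2 t t0) (iWX2 u u0).
rewrite /= Esu Eu1 => E2.
move: E1 E2.
set ht := Ex (fun w => W w * X t w ^+ 2); set hu := Ex (fun w => W w * X u w ^+ 2).
set hs := Ex (fun w => W w * X s w ^+ 2); set s1 := Ex (fun w => W w * X s w).
set o := Ex W => E1 E2.
have us0 : u - s != 0 by rewrite subr_eq0 gt_eqF.
have ts0 : t - s != 0 by rewrite subr_eq0 gt_eqF.
have ut0 : u - t != 0 by rewrite subr_eq0 gt_eqF.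
have de0 : u + tau - q * s != 0 by exact: den_neq0.
have hu_E : hu = hs + (u - s) / (t - s) * (ht - hs).
  by rewrite E1; field; rewrite us0 ts0.
apply/eqP; rewrite -subr_eq0; apply/eqP.
(* Once [hu] is eliminated, the conditional variance equation is the claimed identity multiplied by
   this factor. *)
have c0 : (u - t) / (u + tau - q * s) != 0 by rewrite mulf_neq0 ?invr_eq0.
apply: (mulfI c0); rewrite mulr0.
rewrite -[RHS](subrr ht) {3}E2 hu_E.
by field; rewrite us0 ts0 de0.
Qed.

(** The time-reversed counterpart of [past_second_moment]: with an auxiliary earlier time r, E(W X_r
    X_s) is computed by conditioning on the future of s and on F_{r,t}. This expresses E(W X_r^2)
    through the other moments, and the conditional variance on F_{r,t} then determines E(W X_s^2).
    The result does not depend on r. *)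
Lemma future_second_moment s t (M : R) W : 0 < s -> s < t ->
  adapted X `[t, +oo[ W -> (forall w, `|W w| <= M) ->
  Ex (fun w => W w * X s w ^+ 2) =
  (s ^+ 2 / t ^+ 2 + s * (t - s) * tau / ((t + tau) * t ^+ 2)) * Ex (fun w => W w * X t w ^+ 2)
  + s * (t - s) * theta / ((t + tau) * t) * Ex (fun w => W w * X t w)
  + s * (t - s) / (t + tau) * Ex W.
Proof.
move=> s0 st aW WM; have t0 := lt_trans s0 st.
pose r := s / 2; have r0 : 0 < r by rewrite /r; lra.
have rs : r < s by rewrite /r; lra.
have rt := lt_trans rs st.
have mW : measurable_fun setT W by exact: adapted_mfun aW.
have sW : sqint W.
  have [m i] := sqint_bounded P M W (fun=> 1) mW WM (sqint_cst P 1).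
  by split=> //; apply: eq_integ i => w; rewrite mulr1.
have sWX x : 0 < x -> sqint (fun w => W w * X x w).
  by move=> x0; exact: (sqint_bounded P M _ _ mW WM (sqint_X x x0)).
have iWX2 x : 0 < x -> integ (fun w => W w * X x w ^+ 2).
  move=> x0; apply: eq_integ (sqint_mul P _ _ (sWX x x0) (sqint_X x x0)) => w.
  by rewrite -mulrA -expr2.
have X2E x y : Ex (fun w => W w * X x w * X y w) = Ex (fun w => W w * X y w * X x w).
  by apply: eq_Ex => w; ring.
have X2s x : Ex (fun w => W w * X x w * X x w) = Ex (fun w => W w * X x w ^+ 2).
  by apply: eq_Ex => w; rewrite -mulrA -expr2.
have aXs : adapted X `[s, +oo[ (X s) by apply: adapted_X; rewrite /= in_itv/= lexx.
have aXt : adapted X `[t, +oo[ (X t) by apply: adapted_X; rewrite /= in_itv/= lexx.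
have aXr : adapted X `]0, r] (X r) by apply: adapted_X; rewrite /= in_itv/= r0 lexx.
have aWs : adapted X `[s, +oo[ W by apply: adapted_subset aW; apply: future_subset; exact: ltW.
have aWrt : adapted X (`]0, r] `|` `[t, +oo[) W.
  by apply: adapted_subset aW; exact: future_two_sided.
have Er1 : Ex (fun w => W w * X r w) = r / t * Ex (fun w => W w * X t w).
  by apply: future_mean => //; exact: ltW.
have Etr : Ex (fun w => W w * X r w * X t w) = r / t * Ex (fun w => W w * X t w ^+ 2).
  by rewrite X2E (future_mean r t) ?X2s//; [exact: ltW|exact: adaptedM|exact: sWX].
have Esr : Ex (fun w => W w * X r w * X s w) = r / s * Ex (fun w => W w * X s w ^+ 2).
  by rewrite X2E (future_mean r s) ?X2s//; [exact: ltW|exact: adaptedM|exact: sWX].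
have := harness_mean r s t (fun w => W w * X r w) r0 rs st.
rewrite Esr Etr X2s => /(_ _ (sWX r r0)) E1.
have {}E1 := E1 (adaptedM X _ _ _ aWrt (adapted_subset X _ _ _ (past_two_sided r t) aXr)).
have := harness_second_moment r s t W r0 rs st aWrt (sqint_integ P _ sW)
  (iWX2 r r0) (iWX2 s s0) (iWX2 t t0).
rewrite /= Etr Er1 => E2.
move: E1 E2.
set ht := Ex (fun w => W w * X t w ^+ 2); set hr := Ex (fun w => W w * X r w ^+ 2).
set hs := Ex (fun w => W w * X s w ^+ 2); set t1 := Ex (fun w => W w * X t w).
set o := Ex W => E1 E2.
have tr0 : t - r != 0 by rewrite subr_eq0 gt_eqF.
have ts0 : t - s != 0 by rewrite subr_eq0 gt_eqF.
have sr0 : s - r != 0 by rewrite subr_eq0 gt_eqF.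
have tz : t != 0 by rewrite gt_eqF.
have sz : s != 0 by rewrite gt_eqF.
have rz : r != 0 by rewrite gt_eqF.
have dt0 : t + tau != 0 by rewrite gt_eqF//; have := tau_ge0; lra.
have de0 : t + tau - q * r != 0 by exact: den_neq0.
have hr_E : hr = (t - r) / (t - s) * (r / s * hs - (s - r) / (t - r) * (r / t * ht)).
  by rewrite E1; field; rewrite tr0 ts0 tz.
apply/eqP; rewrite -subr_eq0; apply/eqP.
have c0 : (s - r) * (t + tau) / (s * (t + tau - q * r)) != 0.
  by rewrite !mulf_neq0 ?invr_eq0 ?mulf_neq0.
apply: (mulfI c0); rewrite mulr0.
rewrite -[RHS](subrr hs) {3}E2 hr_E.
clearbody r.
by field; rewrite ?tr0 ?ts0 ?tz ?sz ?dt0 ?de0.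
Qed.

End harness.

(** * Finiteness of all moments *)

Section truncated_powers.
Context {R : realType}.
Implicit Types x y a b K M : R.

(** A Lipschitz bound with constant of order a^(k-1), multiplied by a so that k = 0 and a = 0 need
    no separate form. *)
Lemma power_increment k K : 0 <= K -> exists2 C, 0 <= C &
  forall a b, 0 <= a -> 0 <= b -> b <= K * a ->
    a * `|b ^+ k - a ^+ k| <= C * a ^+ k * `|b - a|.
Proof.
move=> K0; elim: k => [|k [C C0 IH]].
  by exists 0 => // a b _ _ _; rewrite !expr0 subrr normr0 mulr0 !mul0r.
exists (K * C + 1) => [|a b a0 b0 bK]; first by rewrite addr_ge0 ?mulr_ge0.
have -> : b ^+ k.+1 - a ^+ k.+1 = b * (b ^+ k - a ^+ k) + a ^+ k * (b - a).
  by rewrite !exprS; ring.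
apply: le_trans (_ : b * (a * `|b ^+ k - a ^+ k|) + a ^+ k.+1 * `|b - a| <= _).
  rewrite exprS mulrCA -mulrA -mulrDr ler_wpM2l// (le_trans (ler_normD _ _))//.
  by rewrite !normrM (ger0_norm b0) (ger0_norm (exprn_ge0 k a0)).
have h := IH a b a0 b0 bK.
have h1 : b * (a * `|b ^+ k - a ^+ k|) <= (K * a) * (C * a ^+ k * `|b - a|).
  apply: ler_pM => //; by rewrite mulr_ge0.
rewrite exprS; lra.
Qed.

Lemma min_lipschitz M a b : `|Num.min a M - Num.min b M| <= `|a - b|.
Proof.
rewrite ler_norml; have := ler_norm (a - b); have := ler_norm (- (a - b)).
rewrite normrN; case: (leP a M) => ?; case: (leP b M) => ? h1 h2;
  by apply/andP; split; lra.
Qed.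

(* If [|y| <= K |x|] the increment is Lipschitz; otherwise [x] is negligible. *)
Lemma truncated_power_increment k K : 1 <= K -> exists2 C, 0 <= C &
  forall M x y, 0 <= M ->
    x * (y - x) * (Num.min (`|y| ^+ k) M - Num.min (`|x| ^+ k) M)
    <= 2 / K * (Num.min (`|y| ^+ k) M * y ^+ 2) + C * (`|x| ^+ k * (y - x) ^+ 2).
Proof.
move=> K1; have K0 : 0 < K by lra.
have [C C0 hC] := power_increment k K (ltW K0); exists C => // M x y M0.
set fy := Num.min _ _; set fx := Num.min _ _.
have fy0 : 0 <= fy by rewrite le_min M0 exprn_ge0.
have fx0 : 0 <= fx by rewrite le_min M0 exprn_ge0.
apply: le_trans (ler_norm _) _; rewrite !normrM.
have [yK|Ky] := leP `|y| (K * `|x|).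
  apply: ler_wpDl.
    apply: mulr_ge0; first by apply: divr_ge0; lra.
    by apply: mulr_ge0 => //; exact: sqr_ge0.
  have h1 := hC _ _ (normr_ge0 x) (normr_ge0 y) yK.
  have h2 := min_lipschitz M (`|y| ^+ k) (`|x| ^+ k).
  have h3 : `| `|y| - `|x| | <= `|y - x| := ler_dist_dist y x.
  rewrite -/fy -/fx in h2.
  rewrite mulrAC; apply: le_trans (_ : C * `|x| ^+ k * `|y - x| * `|y - x| <= _).
    rewrite ler_wpM2r//; apply: le_trans (_ : `|x| * `| `|y| ^+ k - `|x| ^+ k| <= _).
      by rewrite ler_wpM2l.
    by apply: (le_trans h1); rewrite ler_wpM2l// mulr_ge0// exprn_ge0.
  by rewrite -(real_normK (num_real (y - x))) expr2 !mulrA.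
apply: ler_wpDr.
  by apply: mulr_ge0 => //; apply: mulr_ge0; [rewrite exprn_ge0|exact: sqr_ge0].
have xy : `|x| <= `|y|.
  by apply: le_trans (ltW Ky); rewrite ler_peMl.
have fxy : fx <= fy.
  rewrite le_min [X in _ && X]ge_min lexx orbT andbT ge_min; apply/orP; left.
  by rewrite lerXn2r ?nnegrE.
have h1 : `|fy - fx| <= fy by rewrite ger0_norm ?subr_ge0// lerBlDr lerDl.
have h2 : `|y - x| <= 2 * `|y| by apply: (le_trans (ler_normB _ _)); lra.
have h3 : `|x| <= `|y| / K by rewrite ler_pdivlMr// mulrC ltW.
apply: le_trans (_ : (`|y| / K) * (2 * `|y|) * fy <= _).
  by rewrite !ler_pM ?mulr_ge0.
rewrite -(real_normK (num_real y)) le_eqVlt; apply/orP; left; apply/eqP.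
by field; rewrite gt_eqF.
Qed.

End truncated_powers.

Section finite_moments.
Context {d : measure_display} {T : measurableType d} {R : realType}.
Context {P : probability T R}.
Variable X : R -> {RV P >-> R}.
Variables q eta theta tau : R.
Hypothesis XH : quadratic_harness X q eta theta 0 tau.
Hypothesis q1 : q <= 1.
Implicit Types (W f g : T -> R).
Local Notation integ := (integ P).
Local Notation Ex := (expect P).
Local Notation sqint := (sqint P).

(** The cross term is removed by the martingale property, leaving the increment of second moments,
    which is linear in X_s. This linearity is what lets [moment_step] gain a power: |X_s|^k (X_t -
    X_s)^2 costs only k + 1 moments. *)
Lemma past_increment s t : 0 < s -> s < t ->
  is_cond_exp P (past X s) (fun w => (X t w - X s w) ^+ 2)
    (fun w => (t - s) * (1 + eta * X s w)).
Proof.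
move=> s0 st; have t0 := lt_trans s0 st.
have [mXs iXs2] := sqint_X X _ _ _ _ XH s s0.
have [mXt iXt2] := sqint_X X _ _ _ _ XH t t0.
have iXs := sqint_integ P _ (sqint_X X _ _ _ _ XH s s0).
have iXX := sqint_mul P _ _ (sqint_X X _ _ _ _ XH s s0) (sqint_X X _ _ _ _ XH t t0).
have aXs : adapted X `]0, s] (X s) by apply: adapted_X; rewrite /= in_itv/= s0 lexx.
have EZ w : (X t w - X s w) ^+ 2 = \sum_(c <- [:: (1, fun w => X t w ^+ 2);
    (1, fun w => X s w ^+ 2); (- 2, fun w => X s w * X t w)]) c.1 * c.2 w.
  by rewrite !big_cons big_nil /=; ring.
have EY w : (t - s) * (1 + eta * X s w) = \sum_(c <- [:: (t - s, fun=> 1 : R);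
    ((t - s) * eta, X s : T -> R)]) c.1 * c.2 w.
  by rewrite !big_cons big_nil /=; ring.
have i1 := integ_cst P 1.
apply: (cond_expI P _ (generated_measurable X _)).
- by apply: (integ_lin P _ _ EZ).
- by apply: (integ_lin P _ _ EY).
- apply: (adaptedM X); first exact: adapted_cst.
  by apply: adaptedD; [exact: adapted_cst|apply: adaptedM => //; exact: adapted_cst].
move=> A GA; have mA := generated_measurable X _ _ GA.
have aA : adapted X `]0, s] (\1_A : T -> R) by exact: gmfun_indic.
have A1 w : `|\1_A w : R| <= 1.
  by rewrite indicE; case: (w \in A); rewrite ?normr1 ?normr0.
have sA : sqint (fun w => \1_A w * X s w).
  by apply: (sqint_bounded P 1) => //; exact: sqint_X XH _ s0.
have E2 := past_second_moment X _ _ _ _ XH q1 s t 1 _ s0 st aA A1.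
have E1 := past_mean X _ _ _ _ XH s t _ s0 (ltW st) (adaptedM X _ _ _ aA aXs) sA.
have EAZ w : \1_A w * (X t w - X s w) ^+ 2 = \sum_(c <- [:: (1, fun w => \1_A w * X t w ^+ 2);
    (1, fun w => \1_A w * X s w ^+ 2); (- 2, fun w => \1_A w * X s w * X t w)]) c.1 * c.2 w.
  by rewrite !big_cons big_nil /=; ring.
have EAY w : \1_A w * ((t - s) * (1 + eta * X s w)) = \sum_(c <- [:: (t - s, \1_A : T -> R);
    ((t - s) * eta, fun w => \1_A w * X s w)]) c.1 * c.2 w.
  by rewrite !big_cons big_nil /=; ring.
rewrite (Ex_lin P _ _ EAZ) ?(Ex_lin P _ _ EAY).
- rewrite !big_cons !big_nil /= E2 E1.
  rewrite (eq_Ex P (fun w => \1_A w * X s w * X s w) (fun w => \1_A w * X s w ^+ 2)).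
    by ring.
  by move=> w; rewrite -mulrA -expr2.
- split; last by split => //; exact: integ_indic.
  by apply: (bounded_integ P 1); first exact: measurable_indic.
- do !split => //; try exact: integ_indic.
  by apply: eq_integ (integ_indic P A _ mA iXX) => w /=; rewrite mulrA.
Qed.

(** With phi the truncated k-th power, E(phi(X_s) X_s (X_t - X_s)) = 0, while E(phi(X_t) X_s (X_t -
    X_s)) is c E(phi(X_t) X_t^2) up to lower moments. The pointwise bound returns only c/2 times
    that main term, which can be subtracted because truncation makes it finite; the remaining bound
    is uniform in the truncation. *)
Lemma moment_step k :
  (forall t, 0 < t -> integ (fun w => `|X t w| ^+ k.+1)) ->
  (forall t, 0 < t -> integ (fun w => `|X t w| ^+ k.+2)).
Proof.
move=> IH t t0.
have mXn r n : measurable_fun setT (fun w => `|X r w| ^+ n).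
  by apply: measurable_funX; apply: measurableT_comp => //; exact: mX.
have ile r n : 0 < r -> (n <= k.+1)%N -> integ (fun w => `|X r w| ^+ n).
  move=> r0 nk; apply: (le_integ P _ (fun w => 1 + `|X r w| ^+ k.+1)) => //.
    move=> w; rewrite [leRHS]ger0_norm ?addr_ge0 ?exprn_ge0// normrX normr_id.
    have [x1|x1] := leP `|X r w| 1.
      by apply: ler_wpDr; rewrite ?exprn_ge0 ?exprn_ile1.
    by apply: ler_wpDl => //; rewrite ler_eXn2l.
  by apply: integD; [exact: integ_cst|exact: IH].
pose s := t / 2; have s0 : 0 < s by rewrite /s; lra.
have st : s < t by rewrite /s; lra.
have tau0 := tau_ge0 X _ _ _ _ XH.
(* E[X_s^2 | X_t] = rho X_t^2 + beta X_t + gamma and E[X_s | X_t] = (s/t) X_t, so c below is the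
   leading coefficient of E[X_s (X_t - X_s) | X_t]. In general it is s (t-s) / (t (t+tau)), positive
   for every s between 0 and t. *)
pose rho := s ^+ 2 / t ^+ 2 + s * (t - s) * tau / ((t + tau) * t ^+ 2).
pose beta := s * (t - s) * theta / ((t + tau) * t).
pose gamma := s * (t - s) / (t + tau).
pose c := s / t - rho.
have cE : c = t / (4 * (t + tau)).
  rewrite /c /rho /s; field; rewrite !gt_eqF//; lra.
have c0 : 0 < c by rewrite cE divr_gt0//; lra.
have c4 : c <= 1 / 4.
  by rewrite cE ler_pdivrMr; lra.
(* makes the term [2 / K] of [truncated_power_increment] equal to [c / 2] *)
pose K := 4 / c.
have K1 : 1 <= K by rewrite /K ler_pdivlMr//; lra.
have [C C0 hC] := truncated_power_increment k K K1.
have aXs : adapted X `]0, s] (X s) by apply: adapted_X; rewrite /= in_itv/= s0 lexx.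
have aXt : adapted X `[t, +oo[ (X t) by apply: adapted_X; rewrite /= in_itv/= lexx.
have mabs n : measurable_fun setT (fun x : R => `|x| ^+ n).
  by apply: measurable_funX; exact: normr_measurable.
(* A direct bound would need k + 2 moments; replacing the squared increment by its conditional
   expectation needs only k + 1. *)
have iinc : integ (fun w => `|X s w| ^+ k * (X t w - X s w) ^+ 2).
  apply: (integ_test P _ (generated_measurable X _) _ _ _ (past_increment s t s0 st)).
  - by apply: (adapted_comp X _ _ _ (mabs k)).
  - by move=> w; rewrite exprn_ge0.
  - by move=> w; exact: sqr_ge0.
  apply: (le_integ P _ (fun w => (t - s) * `|X s w| ^+ k + (t - s) * `|eta| * `|X s w| ^+ k.+1)).
  - apply: measurable_funM => //; apply: measurable_funM => //.
    by apply: measurable_funD => //; apply: measurable_funM => //; exact: mX.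
  - move=> w; have ts0 : 0 <= t - s by lra.
    rewrite [leRHS]ger0_norm ?addr_ge0 ?mulr_ge0 ?exprn_ge0//.
    rewrite !normrM (ger0_norm (exprn_ge0 k (normr_ge0 _))) (ger0_norm ts0).
    apply: le_trans (_ : `|X s w| ^+ k * ((t - s) * (1 + `|eta| * `|X s w|)) <= _).
      rewrite ler_wpM2l ?exprn_ge0// ler_wpM2l//.
      by rewrite (le_trans (ler_normD _ _))// normr1 normrM.
    by rewrite exprS; lra.
  - by apply: integD; apply: integZ; apply: ile.
pose B := C * Ex (fun w => `|X s w| ^+ k * (X t w - X s w) ^+ 2)
  + `|beta| * Ex (fun w => `|X t w| ^+ k.+1) + `|gamma| * Ex (fun w => `|X t w| ^+ k).
have sXs := sqint_X X _ _ _ _ XH s s0; have sXt := sqint_X X _ _ _ _ XH t t0.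
have key n : integ (fun w => Num.min (`|X t w| ^+ k) n%:R * X t w ^+ 2) /\
    Ex (fun w => Num.min (`|X t w| ^+ k) n%:R * X t w ^+ 2) <= 2 / c * B.
  pose phi (x : R) : R := Num.min (`|x| ^+ k) n%:R.
  have mphi : measurable_fun setT phi by apply: measurable_minr => //; exact: measurable_cst.
  have phi0 x : 0 <= phi x by rewrite le_min exprn_ge0//= ler0n.
  have phin x : `|phi x| <= n%:R by rewrite ger0_norm// ge_min lexx orbT.
  have phik x : phi x <= `|x| ^+ k by rewrite ge_min lexx.
  have aWt : adapted X `[t, +oo[ (fun w => phi (X t w)) by exact: adapted_comp.
  have aWs : adapted X `]0, s] (fun w => phi (X s w)) by exact: adapted_comp.
  have mphiX r : measurable_fun setT (fun w => phi (X r w)).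
    by apply: (measurableT_comp mphi); exact: mX.
  have bX r f : sqint f -> sqint (fun w => phi (X r w) * f w).
    by apply: (sqint_bounded P n%:R).
  have E1 := future_mean X _ _ _ _ XH s t _ s0 (ltW st) (adaptedM X _ _ _ aWt aXt) (bX t _ sXt).
  have E2 := past_mean X _ _ _ _ XH s t _ s0 (ltW st) (adaptedM X _ _ _ aWs aXs) (bX s _ sXs).
  have E3 := future_second_moment X _ _ _ _ XH q1 s t n%:R _ s0 st aWt (fun w => phin _).
  rewrite -/rho -/beta -/gamma in E3.
  have X2 r r' : (fun w => phi (X r w) * X r' w ^+ 2) =1 (fun w => phi (X r w) * X r' w * X r' w).
    by move=> w; rewrite -mulrA -expr2.
  have iXX r a b : sqint (X a) -> sqint (X b) -> integ (fun w => phi (X r w) * X a w * X b w).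
    by move=> sa sb; exact: (sqint_mul P _ _ (bX r _ sa) sb).
  have iX2 r a : sqint (X a) -> integ (fun w => phi (X r w) * X a w ^+ 2).
    by move=> sa; apply: eq_integ (iXX r a a sa sa) => w; rewrite X2.
  split; first exact: iX2.
  set a := Ex _.
  have iphi r : integ (fun w => phi (X r w)) by exact: (bounded_integ P n%:R).
  pose l : seq (R * (T -> R)) := [:: (1, fun w => phi (X t w) * X t w * X s w);
    (- 1, fun w => phi (X t w) * X s w ^+ 2);
    (- 1, fun w => phi (X s w) * X s w * X t w);
    (1, fun w => phi (X s w) * X s w ^+ 2)].
  have lhsE w : X s w * (X t w - X s w) * (phi (X t w) - phi (X s w)) =
      \sum_(c <- l) c.1 * c.2 w.
    by rewrite /l !big_cons big_nil /=; ring.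
  have il : foldr (fun c Q => integ c.2 /\ Q) True l.
    by do !split => //=; do ?[exact: iXX | exact: iX2].
  have : Ex (fun w => X s w * (X t w - X s w) * (phi (X t w) - phi (X s w))) <=
      Ex (fun w => 2 / K * (phi (X t w) * X t w ^+ 2)
        + C * (`|X s w| ^+ k * (X t w - X s w) ^+ 2)).
    apply: le_Ex; first exact: (integ_lin P _ _ lhsE il).
      by apply: integD; apply: integZ => //; exact: iX2.
    by move=> w; exact: hC.
  rewrite (Ex_lin P _ _ lhsE il) /l !big_cons big_nil /= E1 E2 E3.
  rewrite (ExD P) ?(ExZ P); try (by apply: integZ; do ?exact: iX2); try exact: iX2; try exact: iinc.
  rewrite -!(eq_Ex P _ _ (X2 _ _)) -/a.
  have h1 : beta * Ex (fun w => phi (X t w) * X t w) <= `|beta| * Ex (fun w => `|X t w| ^+ k.+1).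
    apply: (le_trans (ler_norm _)); rewrite normrM ler_wpM2l//.
    have i := sqint_integ P _ (bX t _ sXt).
    apply: (le_trans (le_norm_Ex P _ i)); apply: le_Ex => [||w].
    - exact: integ_norm.
    - exact: IH.
    - by rewrite normrM (ger0_norm (phi0 _)) exprSr ler_wpM2r.
  have h2 : gamma * Ex (fun w => phi (X t w)) <= `|gamma| * Ex (fun w => `|X t w| ^+ k).
    apply: (le_trans (ler_norm _)); rewrite normrM ler_wpM2l//.
    rewrite ger0_norm ?Ex_ge0//; apply: le_Ex => //.
    exact: ile.
  move=> h.
  have K2 : 2 / K = c / 2 by rewrite /K; field; rewrite gt_eqF.
  rewrite K2 in h.
  have : c / 2 * a <= B.
    have cE' : c * a = s / t * a - rho * a by rewrite /c mulrBl.
    rewrite /B; lra.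
  by rewrite mulrC -ler_pdivrMl ?divr_gt0// invf_div mulrC.
apply: (eq_integ P (fun w => `|X t w| ^+ k * X t w ^+ 2)).
  by move=> w; rewrite -(real_normK (num_real (X t w))) -exprD addn2.
apply: (integ_truncated P (2 / c * B)) => //.
- by apply: measurable_funX; exact: mX.
- by move=> w; exact: sqr_ge0.
- by move=> n; case: (key n).
- by move=> n; case: (key n).
Qed.

Lemma integ_absX n t : 0 < t -> integ (fun w => `|X t w| ^+ n).
Proof.
have h2 k : forall t, 0 < t -> integ (fun w => `|X t w| ^+ k.+2).
  elim: k => [|k IH] r r0; last exact: moment_step.
  have [_ i] := sqint_X X _ _ _ _ XH r r0.
  by apply: eq_integ i => w /=; rewrite real_normK// num_real.
case: n => [|[|n]] t0; last exact: h2.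
  by apply: (eq_integ P (fun=> 1)); [move=> w; rewrite expr0|exact: integ_cst].
apply: (eq_integ P (fun w => `|X t w|)) => [w|]; first by rewrite expr1.
exact/integ_norm/sqint_integ/(sqint_X X _ _ _ _ XH).
Qed.

End finite_moments.

(** * Variables with finite moments of all orders *)

Section all_moments.
Context {d : measure_display} {T : measurableType d} {R : realType}.
Variable P : probability T R.
Implicit Types (f g : T -> R).
Local Notation integ := (integ P).

(** Requiring all orders at once gives a class closed under sums and products, so integrability of
    polynomial expressions needs no degree count. *)
Definition moments f := measurable_fun setT f /\ forall n, integ (fun w => `|f w| ^+ n).

Lemma moments_cst c : moments (fun=> c).
Proof. by split=> [|n]; [exact: measurable_cst|exact: integ_cst]. Qed.

Lemma momentsM f g : moments f -> moments g -> moments (fun w => f w * g w).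
Proof.
move=> [mf fi] [mg gi]; have mfg := measurable_funM mf mg; split=> // n.
apply: (le_integ P _ (fun w => `|f w| ^+ (2 * n) + `|g w| ^+ (2 * n))).
- by apply: measurable_funX; exact: measurableT_comp.
- move=> w; rewrite normrX normr_id [leRHS]ger0_norm ?addr_ge0 ?exprn_ge0//.
  rewrite normrM exprMn ![(2 * n)%N]mulnC !exprM.
  have := sqr_ge0 (`|f w| ^+ n - `|g w| ^+ n).
  have := exprn_ge0 n (normr_ge0 (f w)); have := exprn_ge0 n (normr_ge0 (g w)).
  nra.
- exact: integD.
Qed.

Lemma momentsD f g : moments f -> moments g -> moments (fun w => f w + g w).
Proof.
move=> [mf fi] [mg gi]; have mfg := measurable_funD mf mg; split=> // n.
apply: (le_integ P _ (fun w => 2 ^+ n * (`|f w| ^+ n + `|g w| ^+ n))).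
- by apply: measurable_funX; exact: measurableT_comp.
- move=> w; rewrite normrX normr_id [leRHS]ger0_norm; last first.
    by rewrite mulr_ge0 ?addr_ge0 ?exprn_ge0.
  have [fg|gf] := leP `|f w| `|g w|.
    apply: le_trans (_ : (2 * `|g w|) ^+ n <= _).
      by rewrite lerXn2r ?nnegrE ?mulr_ge0// (le_trans (ler_normD _ _))//; lra.
    by rewrite exprMn ler_wpM2l ?exprn_ge0// ler_wpDl ?exprn_ge0.
  apply: le_trans (_ : (2 * `|f w|) ^+ n <= _).
    by rewrite lerXn2r ?nnegrE ?mulr_ge0// (le_trans (ler_normD _ _))//; lra.
  by rewrite exprMn ler_wpM2l ?exprn_ge0// ler_wpDr ?exprn_ge0.
- by apply: integZ; exact: integD.
Qed.

Lemma moments_integ f : moments f -> integ f.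
Proof.
move=> [mf fi]; apply: (le_integ P _ (fun w => `|f w| ^+ 1)) => // w.
by rewrite expr1 normr_id.
Qed.

Lemma moments_sqint f : moments f -> sqint P f.
Proof.
move=> [mf fi]; split => //; apply: eq_integ (fi 2) => w.
by rewrite real_normK// num_real.
Qed.

Lemma moments_indic (A : set T) : measurable A -> moments (\1_A : T -> R).
Proof.
move=> mA; have m1 := @measurable_indic _ T R setT A mA; split=> // n.
apply: (bounded_integ P 1) => [|w].
  by apply: measurable_funX; exact: measurableT_comp.
rewrite normrX normr_id exprn_ile1// indicE.
by case: (w \in A); rewrite ?normr1 ?normr0.
Qed.

Lemma moments_horner (r : {poly R}) f : moments f -> moments (fun w => r.[f w]).
Proof.
move=> mf; elim/poly_ind: r => [|r c IH].
  rewrite (_ : (fun _ => _) = fun=> 0); first exact: moments_cst.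
  by apply/funext => w; rewrite horner0.
rewrite (_ : (fun _ => _) = fun w => r.[f w] * f w + c).
  by apply: momentsD; [exact: momentsM|exact: moments_cst].
by apply/funext => w; rewrite !hornerE.
Qed.

Lemma sqint_Lfun f : sqint P f -> f \in Lfun P 2%:E.
Proof.
move=> [mf fi]; rewrite inE; apply/andP; split; rewrite inE//=.
rewrite /finite_norm unlock /Lnorm.
apply: poweR_lty.
have /integrableP[_] := fi.
apply: le_lt_trans; rewrite le_eqVlt; apply/orP; left; apply/eqP.
apply: eq_integral => w _; rewrite /= powR_mulrn ?normr_ge0//.
by rewrite normrX.
Qed.

End all_moments.

(** * The martingale property *)

Section harness_polynomials.
Context {R : realType}.
Variables (q eta theta tau : R).
Local Notation jb := (jacobi_diag q eta theta tau).
Local Notation jc := (jacobi_sub q eta theta tau).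

(** The inner match exposes the second predecessor as a subterm for structural recursion; since
    [jc 0 t] vanishes, [hpolyS] restores the uniform three-term form. *)
Fixpoint hpoly (n : nat) (t : R) : {poly R} :=
  if n is k.+1 then
    ('X - (jb k t)%:P) * hpoly k t
    - (if k is m.+1 then jc k t *: hpoly m t else 0)
  else 1.

Lemma jb0 t : jb 0 t = 0. Proof. by rewrite /jacobi_diag qnum0 mulr0. Qed.

Lemma jc0 t : jc 0 t = 0. Proof. by rewrite /jacobi_sub qnum0 mulr0. Qed.

Lemma jc1 t : jc 1 t = t.
Proof. by rewrite /jacobi_sub qnumS qnum0 /=; ring. Qed.

Lemma hpolyS n t :
  hpoly n.+1 t = ('X - (jb n t)%:P) * hpoly n t - jc n t *: hpoly n.-1 t.
Proof. by case: n => [|n] //=; rewrite jc0 scale0r. Qed.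

Lemma hpoly1 t : hpoly 1 t = 'X.
Proof. by rewrite hpolyS jb0 jc0 scale0r /= !subr0 mulr1. Qed.

Lemma mulX_hpoly n t :
  'X * hpoly n t = hpoly n.+1 t + jb n t *: hpoly n t + jc n t *: hpoly n.-1 t.
Proof. by rewrite hpolyS -!mul_polyC; ring. Qed.

Lemma hpoly_monic_size n t : hpoly n t \is monic /\ size (hpoly n t) = n.+1.
Proof.
elim/ltn_ind: n => -[_|n IH]; first by rewrite monic1 size_poly1.
have [mn sn] := IH n (leqnn _).
have s1 : size (('X - (jb n t)%:P) * hpoly n t) = n.+2.
  by rewrite size_monicM ?monicXsubC ?monic_neq0// size_XsubC sn.
have lt : (size (- (jc n t *: hpoly n.-1 t)) < size (('X - (jb n t)%:P) * hpoly n t)%R)%N.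
  rewrite size_polyN s1 (leq_ltn_trans (size_scale_leq _ _))//.
  case: n IH {mn sn s1} => [|n] IH; first by rewrite size_poly1.
  by have [_ ->] := IH n (leqnSn _).
rewrite hpolyS; split; last by rewrite size_polyDl.
by rewrite monicE lead_coefDl// -monicE rpredM// monicXsubC.
Qed.

End harness_polynomials.

Arguments hpoly {R} q eta theta tau n t : simpl never.

Section martingale.
Context {d : measure_display} {T : measurableType d} {R : realType}.
Context {P : probability T R}.
Variable X : R -> {RV P >-> R}.
Variables q eta theta tau : R.
Hypothesis XH : quadratic_harness X q eta theta 0 tau.
Hypothesis q1 : q <= 1.
Implicit Types (W f g : T -> R).
Local Notation integ := (integ P).
Local Notation Ex := (expect P).
Local Notation moments := (moments P).
Local Notation jb := (jacobi_diag q eta theta tau).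
Local Notation jc := (jacobi_sub q eta theta tau).
Local Notation J := (jacobi q eta theta tau).
Local Notation hpoly := (hpoly q eta theta tau).

Definition hexp W t n := Ex (fun w => W w * (hpoly n t).[X t w]).

Lemma moments_X t : 0 < t -> moments (X t).
Proof.
move=> t0; split; first exact: mX.
by move=> n; exact: (integ_absX X _ _ _ _ XH q1).
Qed.

Lemma moments_hpoly n t : 0 < t -> moments (fun w => (hpoly n t).[X t w]).
Proof. by move=> t0; apply: moments_horner; exact: moments_X. Qed.

Lemma hexpX W t n : 0 < t -> moments W ->
  hexp (fun w => W w * X t w) t n = J t (hexp W t) n.
Proof.
move=> t0 mW; pose l : seq (R * (T -> R)) :=
  [:: (1, fun w => W w * (hpoly n.+1 t).[X t w]);
      (jb n t, fun w => W w * (hpoly n t).[X t w]);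
      (jc n t, fun w => W w * (hpoly n.-1 t).[X t w])].
have mWp k : integ (fun w => W w * (hpoly k t).[X t w]).
  by apply: moments_integ; apply: momentsM => //; exact: moments_hpoly.
have E w : W w * X t w * (hpoly n t).[X t w] = \sum_(c <- l) c.1 * c.2 w.
  rewrite /l !big_cons big_nil; move: (mulX_hpoly q eta theta tau n t) => /=.
  move: (hpoly n.+1 t) (hpoly n t) (hpoly n.-1 t) => p1 p2 p3 /(congr1 (horner^~ (X t w))).
  by move=> h; rewrite !hornerE in h; rewrite -mulrA h; ring.
by rewrite {1}/hexp (Ex_lin P _ _ E)//= /l !big_cons big_nil /= /hexp /jacobi; ring.
Qed.

Lemma J_affine s t u e n : u - s != 0 ->
  J t e n = (u - t) / (u - s) * J s e n + (t - s) / (u - s) * J u e n.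
Proof. by move=> us0; rewrite /jacobi /jacobi_diag /jacobi_sub; field. Qed.

Lemma adapted_poly I t (r : {poly R}) : I t -> adapted X I (fun w => r.[X t w]).
Proof.
move=> It; apply: (adapted_comp X _ (horner r)); last exact: adapted_X.
exact: measurable_poly.
Qed.

(** Quantified over all pairs of times and all adapted W with moments, not only indicators: the
    induction step uses it between t and u and with W multiplied by X_s or X_t. *)
Definition martingale_upto n := forall k s t W, (k <= n)%N -> 0 < s -> s <= t ->
  adapted X `]0, s] W -> moments W -> hexp W t k = hexp W s k.

Lemma martingale_upto1 : martingale_upto 1.
Proof.
case=> [|[|//]] s t W _ s0 st aW mW; rewrite /hexp.
  by apply: eq_Ex => w; rewrite !hornerE.
have hE r : Ex (fun w => W w * (hpoly 1 r).[X r w]) = Ex (fun w => W w * X r w).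
  by apply: eq_Ex => w; rewrite hpoly1 hornerX.
rewrite !hE.
exact: (past_mean X _ _ _ _ XH s t W s0 st aW (moments_sqint P _ mW)).
Qed.

Lemma martingale_step m : martingale_upto m.+1 -> martingale_upto m.+2.
Proof.
move=> M k s u W; rewrite leq_eqVlt => /predU1P[->|]; last exact: M.
move=> s0; rewrite le_eqVlt => /predU1P[->//|su] aW mW.
(* Any time strictly between s and u would serve. *)
pose t := (s + u) / 2; have st : s < t by rewrite /t; lra.
have tu : t < u by rewrite /t; lra.
have t0 := lt_trans s0 st; have u0 := lt_trans t0 tu.
have us0 : u - s != 0 by rewrite subr_eq0 gt_eqF.
have de0 := den_neq0 X _ _ _ _ XH q1 s u s0 su.
have mXs := moments_X s s0; have mXt := moments_X t t0; have mXu := moments_X u u0.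
have mP n r : 0 < r -> moments (fun w => (hpoly n r).[X r w]) by exact: moments_hpoly.
have aXs : adapted X `]0, s] (X s) by apply: adapted_X; rewrite /= in_itv/= s0 lexx.
have aXt : adapted X `]0, t] (X t) by apply: adapted_X; rewrite /= in_itv/= t0 lexx.
have aWt : adapted X `]0, t] W by apply: adapted_subset aW; apply: past_subset; exact: ltW.
have aWXs := adaptedM X _ _ _ aW aXs; have mWXs := momentsM P _ _ mW mXs.
have aWXt := adaptedM X _ _ _ aWt aXt; have mWXt := momentsM P _ _ mW mXt.
have aWXXs := adaptedM X _ _ _ aWXs aXs; have mWXXs := momentsM P _ _ mWXs mXs.
have aWXXt := adaptedM X _ _ _ aWXt aXt; have mWXXt := momentsM P _ _ mWXt mXt.
pose e := hexp W s; pose et := hexp W t; pose eu := hexp W u.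
have Et j : (j <= m.+1)%N -> et j = e j by move=> jm; apply: M => //; exact: ltW.
have Eu j : (j <= m.+1)%N -> eu j = e j by move=> jm; apply: M => //; exact: ltW.
have mp : (m.-1 <= m.+1)%N by exact: leq_trans (leq_pred m) (leqnSn m).
(* The sequences at times t and u agree with e up to index m + 1. Hence J in row m + 1, and J J in
   row m, differ from their values on e by the single unknown v(m+2) - e(m+2), with coefficient
   1. *)
have Jm r v : (forall j, (j <= m.+1)%N -> v j = e j) -> J r v m = J r e m.
  by move=> vE; rewrite /jacobi !vE.
have Jm1 r v : (forall j, (j <= m.+1)%N -> v j = e j) ->
    J r v m.+1 = J r e m.+1 + (v m.+2 - e m.+2).
  by move=> vE; rewrite /jacobi /= (vE m.+1)// (vE m)//; ring.
have Jmp r v : (forall j, (j <= m.+1)%N -> v j = e j) -> J r v m.-1 = J r e m.-1.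
  move=> vE; rewrite /jacobi !vE//.
    exact: leq_trans (leq_pred _) mp.
  by case: (m).
have JJ r v : (forall j, (j <= m.+1)%N -> v j = e j) ->
    J r (J r v) m = J r (J r e) m + (v m.+2 - e m.+2).
  move=> vE; have JE h : J r h m = h m.+1 + jb m r * h m + jc m r * h m.-1 by [].
  by rewrite (JE (J r v)) (JE (J r e)) Jm1// Jm// Jmp//; ring.
(* F_{s,u} sees X_u, so p_n(X_u; u) may be part of the test variable. Linear regression is tested
   with n = m + 1 and the conditional variance with n = m; both raise the degree to m + 2. *)
pose Wm n w := W w * (hpoly n u).[X u w].
have mWm n : moments (Wm n) by apply: momentsM => //; exact: mP.
have aWm n : adapted X (`]0, s] `|` `[u, +oo[) (Wm n).
  apply: adaptedM; first by apply: adapted_subset aW; exact: past_two_sided.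
  by apply: adapted_poly; right; rewrite /= in_itv/= lexx.
have WmX n r : Ex (fun w => Wm n w * X r w) = hexp (fun w => W w * X r w) u n.
  by apply: eq_Ex => w; rewrite /Wm mulrAC.
have WmXX n r r' : Ex (fun w => Wm n w * X r w * X r' w) =
    hexp (fun w => W w * X r w * X r' w) u n.
  by apply: eq_Ex => w; rewrite /Wm; ring.
have WmX2 n r : Ex (fun w => Wm n w * X r w ^+ 2) =
    hexp (fun w => W w * X r w * X r w) u n.
  by apply: eq_Ex => w; rewrite /Wm; ring.
have E1 := harness_mean X _ _ _ _ XH s t u (Wm m.+1) s0 st tu (aWm _) (moments_sqint P _ (mWm _)).
rewrite !WmX in E1.
(* W X_t belongs to the past of t, so the induction hypothesis moves p_{m+1} from time u to time t,
   where X_t can be absorbed by the recurrence; likewise with s below. *)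
rewrite (M m.+1 t u _ (leqnn _) t0 (ltW tu) aWXt mWXt) in E1.
rewrite (M m.+1 s u _ (leqnn _) s0 (ltW su) aWXs mWXs) in E1.
rewrite !hexpX// -/e -/et -/eu (Jm1 t et Et) (Jm1 u eu Eu) in E1.
rewrite (J_affine s t u)// in E1.
have iWm2 r : 0 < r -> integ (fun w => Wm m w * X r w ^+ 2).
  move=> r0; apply: (eq_integ P (fun w => Wm m w * X r w * X r w)).
    by move=> w; rewrite -mulrA -expr2.
  by apply: moments_integ; do 2 (apply: momentsM; last exact: moments_X).
have := harness_second_moment X _ _ _ _ XH q1 s t u (Wm m) s0 st tu (aWm m)
  (moments_integ P _ (mWm m)) (iWm2 s s0) (iWm2 t t0) (iWm2 u u0).
rewrite /= !WmX2 !WmX WmXX.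
have mSm := leqnSn m.
rewrite (M m t u _ mSm t0 (ltW tu) aWXXt mWXXt) (M m s u _ mSm s0 (ltW su) aWXXs mWXXs).
rewrite (M m s u _ mSm s0 (ltW su) aWXs mWXs).
(* X_u is absorbed first, at time u; the resulting indices are at most m + 1, so they can be moved
   to time s, where X_s is absorbed. *)
have JWs : hexp (fun w => W w * X s w * X u w) u m = J u (J s e) m.
  rewrite hexpX// /jacobi !(M _ s u _ _ s0 (ltW su) aWXs mWXs)// !hexpX//.
have hXX r : 0 < r -> hexp (fun w => W w * X r w * X r w) r m = J r (J r (hexp W r)) m.
  by move=> r0; rewrite hexpX//; [rewrite /jacobi !hexpX//|apply: momentsM => //; exact: moments_X].
rewrite JWs !hXX// !hexpX// -/e -/et -/eu.
rewrite (JJ t et Et) (JJ u eu Eu) (Jm u eu Eu).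
rewrite (_ : Ex (Wm m) = e m); last exact: Eu.
rewrite (J_qcomm q eta theta tau s t u e m us0 de0) => E2.
change (eu m.+2 = e m.+2).
set Dt := et m.+2 - e m.+2 in E1 E2; set Du := eu m.+2 - e m.+2 in E1 E2.
have F1 : Dt = (t - s) / (u - s) * Du.
  apply/eqP; rewrite -subr_eq0; move/eqP : E1; rewrite -subr_eq0 => /eqP E1.
  by apply/eqP; rewrite -E1; ring.
move: E2; set ss := J s (J s e) m; set sU := J u (J s e) m; set uu := J u (J u e) m.
set o := e m; set s1 := J s e m; set u1 := J u e m => E2.
have F2 : Dt = ((t - s) ^+ 2 + (u - t) * (t - s) * (tau + (1 - q) * s) / (u + tau - q * s))
    / (u - s) ^+ 2 * Du.
  by apply/eqP; rewrite -subr_eq0; move/eqP : E2; rewrite -subr_eq0 => /eqP E2;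
    apply/eqP; rewrite -E2; field; rewrite us0 de0.
clearbody Dt.
suff : Du = 0 by move/eqP; rewrite /Du subr_eq0 => /eqP.
(* This is the difference of the coefficients in [F1] and [F2]. *)
have c0 : (t - s) * (u - t) / ((u - s) * (u + tau - q * s)) != 0.
  by rewrite !mulf_neq0 ?invr_eq0 ?mulf_neq0// subr_eq0 gt_eqF.
apply: (mulfI c0); rewrite mulr0 -[RHS](subrr Dt) {1}F1 F2.
by field; rewrite us0 de0.
Qed.

Lemma hpoly_martingale n s t W : 0 < s -> s <= t ->
  adapted X `]0, s] W -> moments W -> hexp W t n = hexp W s n.
Proof.
have M k : martingale_upto k.+1.
  by elim: k => [|k IH]; [exact: martingale_upto1|exact: martingale_step].
by move=> s0 st aW mW; apply: (M n) => //; exact: leqnSn.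
Qed.

End martingale.

(** * Orthogonality and uniqueness *)

Section orthogonal_basis.
Context {d : measure_display} {T : measurableType d} {R : realType}.
Context {P : probability T R}.
Variable Y : {RV P >-> R}.
Hypothesis mY : moments P Y.
Local Notation Ex := (expect P).

(** Subtracting r_m p_m from r of degree at most m lowers the degree, and the term removed is
    orthogonal to p_n since m < n. *)
Lemma orthogonal_lower_degree (p : nat -> {poly R}) :
  (forall n, p n \is monic) -> (forall n, size (p n) = n.+1) ->
  (forall m n, m <> n -> Ex (fun w => (p m).[Y w] * (p n).[Y w]) = 0) ->
  forall (r : {poly R}) n, (size r <= n)%N -> Ex (fun w => r.[Y w] * (p n).[Y w]) = 0.
Proof.
move=> mp sp op r n; suff H k (s : {poly R}) : (size s <= k)%N -> (k <= n)%N ->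
    Ex (fun w => s.[Y w] * (p n).[Y w]) = 0 by exact: (H (size r)).
elim: k s {r} => [|m IH] r.
  rewrite leqn0 size_poly_eq0 => /eqP -> _.
  by rewrite (eq_Ex P _ (fun=> 0)) ?Ex_cst// => w; rewrite horner0 mul0r.
move=> rm mn.
pose r' := r - r`_m *: p m.
have r'm : (size r' <= m)%N.
  apply/leq_sizeP => j; rewrite leq_eqVlt => /predU1P[<-|mj].
    rewrite coefB coefZ; have := mp m; rewrite monicE /lead_coef sp /= => /eqP ->.
    by rewrite mulr1 subrr.
  have rj : r`_j = 0 by rewrite nth_default//; exact: leq_trans mj.
  have pj : (p m)`_j = 0 by rewrite nth_default// sp.
  by rewrite coefB coefZ rj pj mulr0 subr0.
have i (a b : {poly R}) : integ P (fun w => a.[Y w] * b.[Y w]).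
  by apply: moments_integ; apply: momentsM; exact: moments_horner.
pose l : seq (R * (T -> R)) := [:: (1, fun w => r'.[Y w] * (p n).[Y w]);
  (r`_m, fun w => (p m).[Y w] * (p n).[Y w])].
have E w : r.[Y w] * (p n).[Y w] = \sum_(c <- l) c.1 * c.2 w.
  by rewrite /l !big_cons big_nil /= /r' hornerD hornerN hornerZ; ring.
have il : foldr (fun c Q => integ P c.2 /\ Q) True l by do !split => //=; exact: i.
rewrite (Ex_lin P _ _ E il).
rewrite /l !big_cons big_nil /= (IH r' r'm (ltnW mn)) op ?mulr0 ?addr0//.
by move=> mE; rewrite mE ltnn in mn.
Qed.

(** Here r(Y) = 0 almost surely, so the open set where r does not vanish has mass zero and cannot
    meet the support. *)
Lemma root_support (r : {poly R}) : Ex (fun w => r.[Y w] ^+ 2) = 0 ->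
  law_support Y `<=` [set x | root r x].
Proof.
move=> E0 x xY; apply: contrapT => rx.
pose U := [set y | r.[y] != 0].
have oU : open U.
  rewrite (_ : U = horner r @^-1` [set y | y != 0])//.
  by apply: open_comp; [move=> y _; exact: continuous_horner|exact: open_neq].
have /negP := rx; rewrite /root => rx'.
have := xY U (conj oU rx'); rewrite /distribution /= => PU.
have [mr _] := moments_horner P r _ mY.
have i2 : integ P (fun w => r.[Y w] ^+ 2).
  by have [] := moments_sqint P _ (moments_horner P r _ mY).
have ae0 : ae_eq P setT (EFin \o (fun w => r.[Y w] ^+ 2)) (cst 0%E).
  apply/(ae_eq_integral_abs P measurableT); first by apply/measurable_EFinP; exact: measurable_funX.
  transitivity (Ex (fun w => r.[Y w] ^+ 2))%:E; last by rewrite E0.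
  rewrite (EFin_Ex P _ i2); apply: eq_integral => w _ /=.
  by rewrite ger0_norm ?sqr_ge0.
have mU : measurable (Y @^-1` U).
  by rewrite -[_ @^-1` _]setTI; apply: (measurable_funPT Y) => //; exact: open_measurable.
suff P0 : P (Y @^-1` U) = 0%E.
  by move: PU; rewrite /pushforward P0 ltxx.
have [N [mN PN hN]] := ae0.
apply/eqP; rewrite -measure_le0 -PN le_measure ?inE//.
move=> w /= rw; apply: hN => /= /(_ I) [] /eqP.
by rewrite sqrf_eq0 (negPf rw).
Qed.

Lemma finite_roots (r : {poly R}) : r != 0 -> finite_set [set x | root r x].
Proof.
elim: {r}(size r) {-2}r (leqnn (size r)) => [|n IH] r.
  by rewrite leqn0 size_poly_eq0 => ->.
move=> rn r0; have [[a ra]|nor] := pselect (exists a, root r a); last first.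
  rewrite (_ : [set x | root r x] = set0)//.
  by apply/seteqP; split=> // a ra; apply: nor; exists a.
have /factor_theorem[r' r'E] := ra.
have r'0 : r' != 0 by apply: contraNneq r0 => r'0; rewrite r'E r'0 mul0r.
apply: (@sub_finite_set _ _ ([set a] `|` [set x | root r' x])).
  move=> x /=; rewrite r'E rootM root_XsubC => /orP[|/eqP]; [by right|by left].
rewrite finite_setU; split; first exact: finite_set1.
apply: IH => //; move: rn; rewrite r'E size_Mmonic ?monicXsubC//.
by rewrite size_XsubC addn2.
Qed.

End orthogonal_basis.

Section orthogonality.
Context {d : measure_display} {T : measurableType d} {R : realType}.
Context {P : probability T R}.
Variable X : R -> {RV P >-> R}.
Variables q eta theta tau : R.
Hypothesis XH : quadratic_harness X q eta theta 0 tau.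
Hypothesis q1 : q <= 1.
Local Notation Ex := (expect P).
Local Notation moments := (moments P).
Local Notation jb := (jacobi_diag q eta theta tau).
Local Notation jc := (jacobi_sub q eta theta tau).
Local Notation J := (jacobi q eta theta tau).
Local Notation hpoly := (hpoly q eta theta tau).
Local Notation hexp := (hexp X q eta theta tau).

Lemma hpoly_cond_exp n s t : 0 < s -> s < t ->
  is_cond_exp P (past X s) (fun w => (hpoly n t).[X t w]) (fun w => (hpoly n s).[X s w]).
Proof.
move=> s0 st; have t0 := lt_trans s0 st.
have mP r := moments_hpoly X _ _ _ _ XH q1 n r.
apply: (cond_expI P _ (generated_measurable X _)).
- exact/moments_integ/mP.
- exact/moments_integ/mP.
- by apply: adapted_poly; rewrite /= in_itv/= s0 lexx.
move=> A GA; apply/esym.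
apply: (hpoly_martingale X _ _ _ _ XH q1 n s t _ s0 (ltW st)); first exact: gmfun_indic.
by apply: moments_indic; exact: generated_measurable GA.
Qed.

(** By the martingale property e_k = E p_k(X_t; t) does not depend on t. Computing E(X_s p_k(X_t;
    t)) from the past gives J_s e and from the future (s/t) J_t e. With the earlier e_j known, row n
    + 1 of J_s e = (s/t) J_t e leaves e_{n+2} = (s/t) e_{n+2}, hence e_{n+2} = 0. *)
Lemma Ex_hpolyS n t : 0 < t -> Ex (fun w => (hpoly n.+1 t).[X t w]) = 0.
Proof.
pose e r k := hexp (fun=> 1) r k.
have m1 := moments_cst P (1 : R).
have eE r k : Ex (fun w => (hpoly k r).[X r w]) = e r k.
  by apply: eq_Ex => w; rewrite mul1r.
have econst s r k : 0 < s -> s < r -> e r k = e s k.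
  move=> s0 sr; apply: (hpoly_martingale X _ _ _ _ XH q1 k s r _ s0 (ltW sr)) => //.
  exact: adapted_cst.
rewrite eE => t0.
pose s := t / 2; have s0 : 0 < s by rewrite /s; lra.
have st : s < t by rewrite /s; lra.
have mXs := moments_X X _ _ _ _ XH q1 s s0.
have mXt := moments_X X _ _ _ _ XH q1 t t0.
have mPt k := moments_hpoly X _ _ _ _ XH q1 k t t0.
have aXs : adapted X `]0, s] (X s) by apply: adapted_X; rewrite /= in_itv/= s0 lexx.
have JJ k : J s (e t) k = s / t * J t (e t) k.
  have Jhexp r : 0 < r -> hexp (fun w => 1 * X r w) r k = J r (e r) k.
    by move=> r0; exact: (hexpX X _ _ _ _ XH q1 (fun=> 1)).
  transitivity (hexp (fun w => 1 * X s w) t k).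
    rewrite (hpoly_martingale X _ _ _ _ XH q1 k s t _ s0 (ltW st)).
    - by rewrite Jhexp// /jacobi !(econst s t).
    - by apply: adaptedM => //; exact: adapted_cst.
    - exact: momentsM.
  rewrite -Jhexp//.
  have comm r : hexp (fun w => 1 * X r w) t k = Ex (fun w => (hpoly k t).[X t w] * X r w).
    by apply: eq_Ex => w; ring.
  rewrite !comm; apply: (future_mean X _ _ _ _ XH s t _ s0 (ltW st)).
    by apply: adapted_poly; rewrite /= in_itv/= lexx.
  exact: moments_sqint.
have tz : t != 0 by rewrite gt_eqF.
elim/ltn_ind: n => -[_|n IH].
  by rewrite -eE -(Ex_X X _ _ _ _ XH t t0); apply: eq_Ex => w; rewrite hpoly1 hornerX.
have e0 : e t 0 = 1.
  by rewrite -eE -[RHS](Ex_cst P); apply: eq_Ex => w; exact: hornerC.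
have := JJ n.+1; rewrite /jacobi (IH n (leqnn _)) !mulr0 !addr0 /=.
(* Among the earlier terms only e_0 = 1 survives, in row 1, where its coefficient is t; the
   contributions s and (s/t) t cancel. *)
have -> : e t n.+2 + jc n.+1 t * e t n = e t n.+2 + (if n is 0 then t else 0).
  case: n IH => [|n] IH; last by rewrite (IH n)// mulr0.
  by rewrite jc1 e0 mulr1.
have -> : e t n.+2 + jc n.+1 s * e t n = e t n.+2 + (if n is 0 then s else 0).
  case: n IH => [|n] IH; last by rewrite (IH n)// mulr0.
  by rewrite jc1 e0 mulr1.
have st2 : s / t = 1 / 2 by rewrite /s; field.
rewrite st2 /s; case: (n) => [|?]; lra.
Qed.

(** Induction on the smaller index a: the recurrence writes p_{a+1} through X p_a, p_a and p_{a-1},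
    and the factor X is moved onto p_b, which produces the indices b - 1, b and b + 1. As a + 1 < b,
    all of them exceed a. The base case is the vanishing mean. *)
Lemma hpoly_orthogonal m n t : 0 < t -> m <> n ->
  Ex (fun w => (hpoly m t).[X t w] * (hpoly n t).[X t w]) = 0.
Proof.
move=> t0.
have mP k := moments_hpoly X _ _ _ _ XH q1 k t t0.
have lower a b : (a < b)%N -> Ex (fun w => (hpoly a t).[X t w] * (hpoly b t).[X t w]) = 0.
  elim/ltn_ind: a b => -[_|a IH] b ab.
    case: b ab => // b _; rewrite -(Ex_hpolyS b t t0); apply: eq_Ex => w.
    by rewrite hornerC mul1r.
  have f0 k c : (k <= a)%N -> (k < c)%N -> hexp (fun w => (hpoly k t).[X t w]) t c = 0.
    by move=> ka kc; exact: IH.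
  pose l : seq (R * (T -> R)) :=
    [:: (1, fun w => (hpoly a t).[X t w] * X t w * (hpoly b t).[X t w]);
        (- jb a t, fun w => (hpoly a t).[X t w] * (hpoly b t).[X t w]);
        (- jc a t, fun w => (hpoly a.-1 t).[X t w] * (hpoly b t).[X t w])].
  have mXt := moments_X X _ _ _ _ XH q1 t t0.
  have E w : (hpoly a.+1 t).[X t w] * (hpoly b t).[X t w] = \sum_(c <- l) c.1 * c.2 w.
    rewrite /l !big_cons big_nil; move: (mulX_hpoly q eta theta tau a t) => /=.
    move: (hpoly a.+1 t) (hpoly a t) (hpoly a.-1 t) (hpoly b t) => p1 p2 p3 p4.
    move=> /(congr1 (horner^~ (X t w))) h; rewrite !hornerE in h.
    by rewrite [p2.[_] * X t w]mulrC h; ring.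
  have il : foldr (fun c Q => integ P c.2 /\ Q) True l.
    by do !split => //=; apply: moments_integ; do ?apply: momentsM.
  rewrite (Ex_lin P _ _ E il) /l !big_cons big_nil /=.
  have -> : Ex (fun w => (hpoly a t).[X t w] * X t w * (hpoly b t).[X t w]) =
      J t (hexp (fun w => (hpoly a t).[X t w]) t) b.
    exact: (hexpX X _ _ _ _ XH q1 _ t b t0 (mP a)).
  case: b ab {E il l} => // b ab.
  rewrite /jacobi /= !f0//; try solve [exact: ltnW | exact: (ltnW (leqW ab))].
  rewrite (IH a)//; last exact: ltnW.
  have h1 : (a.-1 < a.+1)%N by rewrite ltnS leq_pred.
  have h2 : (a.-1 < b.+1)%N by rewrite (leq_ltn_trans (leq_pred a))// ltnW.
  by rewrite (IH a.-1 h1 b.+1 h2) !(mulr0, addr0).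
move=> /eqP; rewrite neq_ltn => /orP[/lower//|/lower <-].
by apply: eq_Ex => w; rewrite mulrC.
Qed.

Lemma hpoly_martingale_polys : monic_orthogonal_martingale_polys X hpoly.
Proof.
split; last by move=> n t _; have [] := hpoly_monic_size q eta theta tau n t.
have mP n r := moments_hpoly X _ _ _ _ XH q1 n r.
split.
- by move=> n t _; have [] := hpoly_monic_size q eta theta tau n t.
- by move=> n t t0; apply/sqint_Lfun/moments_sqint/mP.
- exact: hpoly_cond_exp.
- move=> n m t t0 nm; rewrite unlock -(EFin_Ex P); first by rewrite hpoly_orthogonal.
  by apply: moments_integ; apply: momentsM; exact: mP.
Qed.

(** The difference r of two monic polynomials of degree n has lower degree, so it is orthogonal to
    both of them and hence to itself. Its roots then contain the infinite support, which forces r =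
    0. *)
Lemma martingale_polys_unique (p : nat -> R -> {poly R}) t n : 0 < t ->
  infinite_set (law_support (X t)) ->
  monic_orthogonal_martingale_polys X p -> p n t = hpoly n t.
Proof.
move=> t0 inf [[psize _ _ porth] pmonic].
have mXt := moments_X X _ _ _ _ XH q1 t t0.
have mr (r : {poly R}) : moments (fun w => r.[X t w]) by exact: moments_horner.
pose r := p n t - hpoly n t.
have [hm hs] := hpoly_monic_size q eta theta tau n t.
have rn : (size r <= n)%N.
  apply/leq_sizeP => j; rewrite leq_eqVlt => /predU1P[<-|nj].
    have := pmonic n t t0; have := hm; rewrite !monicE /lead_coef hs psize//=.
    by rewrite coefB => /eqP -> /eqP ->; rewrite subrr.
  by rewrite coefB !nth_default ?subrr// ?hs ?psize.
have op m k : m <> k -> Ex (fun w => (p m t).[X t w] * (p k t).[X t w]) = 0.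
  move=> mk; have := porth m k t t0 mk; rewrite unlock -(EFin_Ex P); first by case.
  by apply: moments_integ; exact: momentsM.
have rp : Ex (fun w => r.[X t w] * (p n t).[X t w]) = 0.
  apply: (orthogonal_lower_degree _ mXt (fun k => p k t)) => //.
  - by move=> k; exact: pmonic.
  - by move=> k; exact: psize.
have rh : Ex (fun w => r.[X t w] * (hpoly n t).[X t w]) = 0.
  apply: (orthogonal_lower_degree _ mXt (fun k => hpoly k t)) => //.
  - by move=> k; have [] := hpoly_monic_size q eta theta tau k t.
  - by move=> k; have [] := hpoly_monic_size q eta theta tau k t.
  - by move=> a b; exact: hpoly_orthogonal.
have r2 : Ex (fun w => r.[X t w] ^+ 2) = 0.
  rewrite (eq_Ex P _ (fun w => r.[X t w] * (p n t).[X t w] - r.[X t w] * (hpoly n t).[X t w])).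
    by rewrite (ExB P) ?rp ?rh ?subrr//; apply: moments_integ; exact: momentsM.
  by move=> w; rewrite -mulrBr /r hornerD hornerN expr2.
apply/eqP; rewrite -subr_eq0 -/r; apply/negPn/negP => r0; apply: inf.
exact: sub_finite_set (root_support _ mXt r r2) (finite_roots r r0).
Qed.

End orthogonality.

Theorem theorem4p5 (d : measure_display) (T : measurableType d) (R : realType)
    (P : probability T R) (X : R -> {RV P >-> R})
    (q eta theta sigma tau : R) :
  quadratic_harness X q eta theta sigma tau ->
  sigma = 0 ->
  -1 < q -> q <= 1 ->
  (forall n : nat,
     0 < 1 + qnum q n * eta * theta + qnum q n ^+ 2 * tau * eta ^+ 2) ->
  (forall t : R, 0 < t -> infinite_set (law_support (X t))) ->
  (exists p : nat -> R -> {poly R}, monic_orthogonal_martingale_polys X p) /\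
  (forall p : nat -> R -> {poly R}, monic_orthogonal_martingale_polys X p ->
     forall t : R, 0 < t ->
       [/\ p 0%N t = 1,
           p 1%N t = 'X &
           forall n : nat, (1 <= n)%N ->
             'X * p n t =
               p n.+1 t
               + ((eta * t + theta
                    + (qnum q n + qnum q n.-1) * eta * tau) * qnum q n)
                 *: p n t
               + ((t + tau * qnum q n.-1)
                  * (1 + qnum q n.-1 * eta * theta
                     + qnum q n.-1 ^+ 2 * tau * eta ^+ 2) * qnum q n)
                 *: p n.-1 t]).
Proof.
move=> XH s0; rewrite {}s0 in XH => _ q1 _ inf.
split; first by exists (hpoly q eta theta tau); exact: hpoly_martingale_polys.
move=> p pP t t0.
have pE n := martingale_polys_unique X _ _ _ _ XH q1 p t n t0 (inf t t0) pP.
split; rewrite ?pE//; first exact: hpoly1.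
by move=> n _; rewrite !pE; exact: mulX_hpoly.
Qed.
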